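(* Let $(R,\mathfrak m)$ be a Noetherian local ring with residue field $\mathfrak k=R/\mathfrak m$, and let $M$ be a finitely generated $R$-module with $\dim M=d$. Let $l$ be a positive integer such that for all parameter ideals $\mathfrak q$ of $M$ contained in $\mathfrak m^l$ and all $i$, the canonical homomorphism on socles $$\mathrm{Soc}(H^i(\mathfrak q,M))\to\mathrm{Soc}(H^i_{\mathfrak m}(M))$$ is surjective. Then the following conditions are equivalent: (i) $M$ is a Cohen-Macaulay module. (ii) $\mathrm{ir}_M(\mathfrak q^{n+1}M)=\dim_{\mathfrak k}\mathrm{Soc}(H^d_{\mathfrak m}(M))\binom{n+d-1}{d-1}$ for all parameter ideals $\mathfrak q$ of $M$ and all $n\ge 0$. (iii) $\mathrm{ir}_M(\mathfrak qM)=\dim_{\mathfrak k}\mathrm{Soc}(H^d_{\mathfrak m}(M))$ for all parameter ideals $\mathfrak q$ of $M$. (iv) There exists a parameter ideal $\mathfrak q$ of $M$ contained in $\mathfrak m^l$ such that $\mathrm{ir}_M(\mathfrak qM)=\dim_{\mathfrak k}\mathrm{Soc}(H^d_{\mathfrak m}(M))$.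
   Context: A submodule $N$ of $M$ is irreducible if it cannot be written as an intersection of two properly larger submodules of $M$. The index of reducibility $\mathrm{ir}_M(N)$ is the number of components of an irredundant decomposition of $N$ as a finite intersection of irreducible submodules of $M$ (no component can be omitted); by Noether this number is independent of the decomposition. A parameter ideal of $M$ is an ideal $\mathfrak q=(x_1,\dots,x_d)$ generated by a system of parameters of $M$, where $d=\dim M$ (i.e. $x_1,\dots,x_d\in\mathfrak m$ and $M/\mathfrak qM$ has finite length). For an $R$-module $L$, $\mathrm{Soc}(L)=0:_L\mathfrak m$, a $\mathfrak k$-vector space. $H^i(\mathfrak q,M)$ is the $i$-th Koszul cohomology module of $M$ with respect to $\mathfrak q=(x_1,\dots,x_d)$, and $H^i_{\mathfrak m}(M)$ is the $i$-th local cohomology module; the canonical homomorphism $H^i(\mathfrak q,M)\to H^i_{\mathfrak m}(M)$ is the one into the direct limit $H^i_{\mathfrak m}(M)=\varinjlim_t H^i((x_1^t,\dots,x_d^t),M)$. A positive integer $l$ with the surjectivity property in the claim always exists, by a lemma of Goto and Sakurai. *)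

(* Defs.v *)
From HB Require Import structures.
From mathcomp Require Import all_boot all_order all_algebra.
From mathcomp Require Import boolp classical_sets.

Set Implicit Arguments.
Unset Strict Implicit.
Unset Printing Implicit Defensive.

Import GRing.Theory.
Local Open Scope ring_scope.
Local Open Scope quotient_scope.

(* Submodules of V are terms of type submodClosed V, membership being made
   boolean with classical logic.  Ideals of R are submodules of the regular
   module R^o; proper ideals and prime ideals are the idealr R and
   prime_idealr R of ring_quotient.v. *)

Section Submodules.
Variables (R : comNzRingType) (V : lmodType R).

Definition span (S : V -> Prop) : {pred V} := fun v =>
  `[< forall N : submodClosed V, (forall u, S u -> u \in N) -> v \in N >].

Fact span_submod S : submod_closed (span S).
Proof.
split=> [|a u v /asboolP Su /asboolP Sv]; apply/asboolP => N SN.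
  exact: rpred0.
by rewrite rpredD ?rpredZ ?Su ?Sv.
Qed.

HB.instance Definition _ S :=
  GRing.isSubmodClosed.Build R V (span S) (span_submod S).

Definition fg_submod (N : {pred V}) : Prop :=
  exists n (b : 'I_n -> V), N =i span (fun v => exists i, v = b i).

Definition proper_sub (N N' : {pred V}) : Prop :=
  {subset N <= N'} /\ ~ {subset N' <= N}.

Definition imul (I : {pred R}) (N : {pred V}) : submodClosed V :=
  span (fun v => exists a u, [/\ a \in I, u \in N & v = a *: u]).

Definition irreducible_submod (N : {pred V}) : Prop :=
  ~ exists N1 N2 : submodClosed V,
      [/\ proper_sub N N1, proper_sub N N2
        & forall v, (v \in N) = (v \in N1) && (v \in N2)].

Definition irredundant_decomposition r (N : {pred V})
    (F : 'I_r -> submodClosed V) : Prop :=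
  [/\ forall i, irreducible_submod (F i),
      forall v, v \in N <-> (forall i, v \in F i)
    & forall j, ~ (forall v, v \in N <-> (forall i, i != j -> v \in F i))].

(* The value does not depend on the decomposition when R is Noetherian and V
   is finitely generated (Noether); 0 if there is no decomposition. *)
Definition index_reducibility (N : {pred V}) : nat :=
  xget 0%N [set r | exists F, @irredundant_decomposition r N F]%classic.

Definition finite_length : Prop :=
  exists b, forall n (N : 'I_n.+1 -> submodClosed V),
    (forall i j : 'I_n.+1, (i < j)%N -> proper_sub (N i) (N j)) -> (n <= b)%N.

End Submodules.

Section QuotientModule.
Variables (R : comNzRingType) (V : lmodType R) (N : submodClosed V).

Definition zmod_pred : {pred V} := N.

HB.instance Definition _ := GRing.isZmodClosed.Build V zmod_pred
  (GRing.submod_closedB (submodClosedP N)).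

Definition quotmod : Type := {ideal_quot zmod_pred}.

HB.instance Definition _ := GRing.Zmodule.on quotmod.

Definition quotmod_pi (v : V) : quotmod := \pi_({ideal_quot zmod_pred}) v.

Definition quotmod_repr (q : quotmod) : V := repr (q : {ideal_quot zmod_pred}).

Definition quotmod_scale (a : R) (q : quotmod) : quotmod :=
  quotmod_pi (a *: quotmod_repr q).

Fact quotmod_piE (u v : V) : quotmod_pi u = quotmod_pi v <-> u - v \in N.
Proof.
rewrite /quotmod_pi (@Quotient.idealrBE V zmod_pred u v).
by split=> [/eqP|/eqP].
Qed.

Fact quotmod_pi_repr (q : quotmod) : quotmod_pi (quotmod_repr q) = q.
Proof. exact: reprK. Qed.

Fact quotmod_piD u v : quotmod_pi (u + v) = quotmod_pi u + quotmod_pi v.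
Proof. exact: raddfD. Qed.

Fact quotmod_scaleE a v :
  quotmod_scale a (quotmod_pi v) = quotmod_pi (a *: v).
Proof.
apply/quotmod_piE; rewrite -scalerBr rpredZ //.
by apply/quotmod_piE; rewrite quotmod_pi_repr.
Qed.

Fact quotmod_scaleA a b q :
  quotmod_scale a (quotmod_scale b q) = quotmod_scale (a * b) q.
Proof. by rewrite -[q]quotmod_pi_repr !quotmod_scaleE scalerA. Qed.

Fact quotmod_scale1 : left_id 1 quotmod_scale.
Proof. by move=> q; rewrite -[q]quotmod_pi_repr quotmod_scaleE scale1r. Qed.

Fact quotmod_scaleDr : right_distributive quotmod_scale +%R.
Proof.
move=> a p q; rewrite -[p]quotmod_pi_repr -[q]quotmod_pi_repr.
by rewrite -quotmod_piD !quotmod_scaleE scalerDr quotmod_piD.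
Qed.

Fact quotmod_scaleDl q : {morph quotmod_scale^~ q : a b / a + b}.
Proof.
move=> a b; rewrite -[q]quotmod_pi_repr.
by rewrite !quotmod_scaleE scalerDl quotmod_piD.
Qed.

HB.instance Definition _ := GRing.Zmodule_isLmodule.Build R quotmod
  quotmod_scaleA quotmod_scale1 quotmod_scaleDr quotmod_scaleDl.

Fact quotmod_pi_linear : linear quotmod_pi.
Proof. by move=> a u v; rewrite quotmod_piD -quotmod_scaleE. Qed.

HB.instance Definition _ :=
  GRing.isLinear.Build R V quotmod *:%R quotmod_pi quotmod_pi_linear.

End QuotientModule.

Section DirectLimit.
Variable R : comNzRingType.

Record dirsys := DirSys {
  dobj :> nat -> lmodType R;
  dmap : forall s t, (s <= t)%N -> dobj s -> dobj t;
  dmap_linear : forall s t (le_st : (s <= t)%N), linear (dmap le_st);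
  dmap_id : forall s (le_ss : (s <= s)%N) a, dmap le_ss a = a;
  dmap_comp : forall s t u (le_st : (s <= t)%N) (le_tu : (t <= u)%N)
      (le_su : (s <= u)%N) a,
    dmap le_tu (dmap le_st a) = dmap le_su a
}.

Variable D : dirsys.

HB.instance Definition _ s t (le_st : (s <= t)%N) :=
  GRing.isLinear.Build R (D s) (D t) *:%R (@dmap D s t le_st)
    (@dmap_linear D s t le_st).

Let T := {t : nat & D t : Type}.

Definition dlim_eq (p q : T) : bool :=
  `[< exists u (le_pu : (tag p <= u)%N) (le_qu : (tag q <= u)%N),
        dmap le_pu (tagged p) = dmap le_qu (tagged q) >].

Fact dlim_eq_equiv : equiv_class_of dlim_eq.
Proof.
split=> [p|p q|q p r].
- by apply/asboolP; exists (tag p), (leqnn _), (leqnn _).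
- by apply/asboolP/asboolP => -[u [hp [hq e]]]; exists u, hq, hp.
move=> /asboolP[u [hp [hq e]]] /asboolP[v [hq' [hr e']]]; apply/asboolP.
have hu := leq_maxl u v; have hv := leq_maxr u v.
exists (maxn u v), (leq_trans hp hu), (leq_trans hr hv).
rewrite -(dmap_comp hp hu) -(dmap_comp hr hv) e -e'.
by rewrite !(dmap_comp _ _ (leq_trans hq hu)).
Qed.

Canonical dlim_equiv := EquivRelPack dlim_eq_equiv.
Canonical dlim_enc := defaultEncModRel dlim_eq.

Definition dlim : Type := {eq_quot dlim_eq}.

HB.instance Definition _ := Choice.on dlim.

Definition dlim_in t (a : D t) : dlim := \pi_({eq_quot dlim_eq}) (@Tagged nat _ (fun t => D t : Type) a).

Fact dlim_inE s t (a : D s) (b : D t) :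
  dlim_in a = dlim_in b <->
  exists u (le_su : (s <= u)%N) (le_tu : (t <= u)%N),
    dmap le_su a = dmap le_tu b.
Proof.
by split=> [/eqmodP/asboolP|h]; last exact/eqmodP/asboolP.
Qed.

Fact dlim_in_map s t (le_st : (s <= t)%N) (a : D s) :
  dlim_in (dmap le_st a) = dlim_in a.
Proof.
by apply/dlim_inE; exists t, (leqnn t), le_st; rewrite dmap_id.
Qed.

Fact dlim_surj (p : dlim) : exists t (a : D t), p = dlim_in a.
Proof.
rewrite -[p](reprK (p : {eq_quot dlim_eq})).
by case: (repr _) => t a; exists t, a.
Qed.

Definition dlim_rep (p : dlim) : T := repr (p : {eq_quot dlim_eq}).

Definition dlim_zero : dlim := dlim_in (0 : D 0%N).
Definition dlim_opp (p : dlim) : dlim := dlim_in (- tagged (dlim_rep p)).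
Definition dlim_add (p q : dlim) : dlim :=
  dlim_in (dmap (leq_maxl (tag (dlim_rep p)) (tag (dlim_rep q)))
             (tagged (dlim_rep p))
         + dmap (leq_maxr (tag (dlim_rep p)) (tag (dlim_rep q)))
             (tagged (dlim_rep q))).
Definition dlim_scale (c : R) (p : dlim) : dlim :=
  dlim_in (c *: tagged (dlim_rep p)).

Fact dlim_rep_in (p : dlim) : dlim_in (tagged (dlim_rep p)) = p.
Proof.
rewrite /dlim_rep -[RHS](reprK (p : {eq_quot dlim_eq})).
by case: (repr _).
Qed.

Fact dlim_oppE t (a : D t) : dlim_opp (dlim_in a) = dlim_in (- a).
Proof.
have /dlim_inE[u [h1 [h2 e]]] := dlim_rep_in (dlim_in a).
by apply/dlim_inE; exists u, h1, h2; rewrite !raddfN /= e.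
Qed.

Fact dlim_scaleE c t (a : D t) : dlim_scale c (dlim_in a) = dlim_in (c *: a).
Proof.
have /dlim_inE[u [h1 [h2 e]]] := dlim_rep_in (dlim_in a).
by apply/dlim_inE; exists u, h1, h2; rewrite !linearZ /= e.
Qed.

Fact dlim_addE t (a b : D t) :
  dlim_add (dlim_in a) (dlim_in b) = dlim_in (a + b).
Proof.
have /dlim_inE[u [h1 [h2 e]]] := dlim_rep_in (dlim_in a).
have /dlim_inE[v [k1 [k2 f]]] := dlim_rep_in (dlim_in b).
rewrite /dlim_add.
set p := dlim_rep _ in h1 e *; set q := dlim_rep _ in k1 f *.
have hu := leq_maxl u v; have hv := leq_maxr u v.
have ht := leq_trans h2 hu.
have hm : (maxn (tag p) (tag q) <= maxn u v)%N.
  by rewrite geq_max (leq_trans h1 hu) (leq_trans k1 hv).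
apply/dlim_inE; exists (maxn u v), hm, ht.
rewrite !raddfD /= (dmap_comp _ _ (leq_trans h1 hu)).
rewrite (dmap_comp _ _ (leq_trans k1 hv)).
rewrite -(dmap_comp h1 hu) -(dmap_comp k1 hv) e f.
by rewrite (dmap_comp _ _ ht) (dmap_comp _ _ ht).
Qed.

Fact dlim_surj2 (p q : dlim) :
  exists t (a b : D t), p = dlim_in a /\ q = dlim_in b.
Proof.
have [s [a ->]] := dlim_surj p; have [t [b ->]] := dlim_surj q.
exists (maxn s t), (dmap (leq_maxl s t) a), (dmap (leq_maxr s t) b).
by rewrite !dlim_in_map.
Qed.

Fact dlim_addA : associative dlim_add.
Proof.
move=> p q r; have [s [a [b [-> ->]]]] := dlim_surj2 p q.
have [t [c ->]] := dlim_surj r.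
rewrite -(dlim_in_map (leq_maxl s t) a) -(dlim_in_map (leq_maxl s t) b).
by rewrite -(dlim_in_map (leq_maxr s t) c) !dlim_addE addrA.
Qed.

Fact dlim_addC : commutative dlim_add.
Proof.
by move=> p q; have [s [a [b [-> ->]]]] := dlim_surj2 p q; rewrite !dlim_addE addrC.
Qed.

Fact dlim_add0 : left_id dlim_zero dlim_add.
Proof.
move=> p; have [t [a ->]] := dlim_surj p.
by rewrite /dlim_zero -(dlim_in_map (leq0n t)) dlim_addE raddf0 add0r.
Qed.

Fact dlim_addN : left_inverse dlim_zero dlim_opp dlim_add.
Proof.
move=> p; have [t [a ->]] := dlim_surj p.
rewrite dlim_oppE dlim_addE addNr /dlim_zero.
by rewrite -[RHS](dlim_in_map (leq0n t)) raddf0.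
Qed.

HB.instance Definition _ :=
  GRing.isZmodule.Build dlim dlim_addA dlim_addC dlim_add0 dlim_addN.

Fact dlim_scaleA a b p : dlim_scale a (dlim_scale b p) = dlim_scale (a * b) p.
Proof. by have [t [c ->]] := dlim_surj p; rewrite !dlim_scaleE scalerA. Qed.

Fact dlim_scale1 : left_id 1 dlim_scale.
Proof.
by move=> p; have [t [c ->]] := dlim_surj p; rewrite dlim_scaleE scale1r.
Qed.

Fact dlim_scaleDr : right_distributive dlim_scale +%R.
Proof.
move=> a p q; have [s [b [c [-> ->]]]] := dlim_surj2 p q.
rewrite [_ + _]dlim_addE !dlim_scaleE scalerDr.
exact/esym/dlim_addE.
Qed.

Fact dlim_scaleDl p : {morph dlim_scale^~ p : a b / a + b}.
Proof.
move=> a b; have [t [c ->]] := dlim_surj p.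
rewrite !dlim_scaleE scalerDl; exact/esym/dlim_addE.
Qed.

HB.instance Definition _ := GRing.Zmodule_isLmodule.Build R dlim
  dlim_scaleA dlim_scale1 dlim_scaleDr dlim_scaleDl.

Fact dlim_in_linear t : linear (@dlim_in t).
Proof.
move=> c a b; rewrite -[RHS]/(dlim_add (dlim_scale c (dlim_in a)) (dlim_in b)).
by rewrite dlim_scaleE dlim_addE.
Qed.

HB.instance Definition _ t :=
  GRing.isLinear.Build R (D t) dlim *:%R (@dlim_in t) (@dlim_in_linear t).

End DirectLimit.

Section Koszul.
Variables (R : comNzRingType) (M : lmodType R) (d : nat).
Implicit Types (x : 'I_d -> R) (J : {set 'I_d}) (i : nat).

(* The whole Koszul cochain complex Hom(/\ R^d, M): f J is the value of f at
   the wedge of the e_j, j in J, taken in increasing order.  The cochains of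
   degree i are the f vanishing off the subsets with i elements. *)
Definition kcochain : Type := {ffun {set 'I_d} -> M}.
HB.instance Definition _ := GRing.Lmodule.on kcochain.

Definition kdeg i (f : kcochain) : bool :=
  [forall J : {set 'I_d}, (#|J| != i) ==> (f J == 0)].

Definition kdiff x (f : kcochain) : kcochain :=
  [ffun J : {set 'I_d} => \sum_(j in J)
     ((-1) ^+ #|[set k in J | (k < j)%N]| * x j) *: f (J :\ j)].

Fact kdegP i (f : kcochain) :
  reflect (forall J, #|J| != i -> f J = 0) (kdeg i f).
Proof.
by apply: (iffP 'forall_implyP) => h J hJ; [apply/eqP|rewrite h]; rewrite ?h.
Qed.

Fact kdiff_linear x : linear (kdiff x).
Proof.
move=> a f g; apply/ffunP => J; rewrite !ffunE scaler_sumr -big_split /=.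
apply: eq_bigr => j _; rewrite !ffunE scalerDr !scalerA; congr (_ *: _ + _).
by rewrite mulrC.
Qed.

HB.instance Definition _ x :=
  GRing.isLinear.Build R kcochain kcochain *:%R (kdiff x) (kdiff_linear x).

Fact kdeg_submod i : submod_closed (kdeg i).
Proof.
split=> [|a f g /kdegP hf /kdegP hg]; apply/kdegP => J hJ; rewrite !ffunE //.
by rewrite hf // hg // scaler0 addr0.
Qed.

HB.instance Definition _ i :=
  GRing.isSubmodClosed.Build R kcochain (kdeg i) (kdeg_submod i).

Definition kcocycle x i : {pred kcochain} :=
  fun f => (f \in kdeg i) && (kdiff x f == 0).

Fact kcocycle_submod x i : submod_closed (kcocycle x i).
Proof.
split=> [|a f g /andP[df /eqP cf] /andP[dg /eqP cg]]; apply/andP; split.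
- exact: rpred0.
- by rewrite raddf0.
- by rewrite rpredD ?rpredZ.
by rewrite linearP /= cf cg scaler0 addr0.
Qed.

HB.instance Definition _ x i :=
  GRing.isSubmodClosed.Build R kcochain (kcocycle x i) (kcocycle_submod x i).

Definition kZ x i : Type := {f : kcochain | f \in kcocycle x i}.
HB.instance Definition _ x i := SubChoice.on (kZ x i).
HB.instance Definition _ x i := [SubChoice_isSubLmodule of kZ x i by <:].

(* In degree 0 only g = 0 satisfies the side condition. *)
Definition kcoboundary x i : {pred kZ x i} := fun f =>
  `[< exists g : kcochain,
        (forall J, #|J|.+1 != i -> g J = 0) /\ val f = kdiff x g >].

Fact kcoboundary_submod x i : submod_closed (@kcoboundary x i).
Proof.
split=> [|a f g /asboolP[u [hu eu]] /asboolP[v [hv ev]]]; apply/asboolP.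
  by exists 0; split=> [J _|]; rewrite ?ffunE // !raddf0.
exists (a *: u + v); split=> [J hJ|].
  by rewrite !ffunE hu // hv // scaler0 addr0.
by rewrite linearP /= linearP /= eu ev.
Qed.

HB.instance Definition _ x i := GRing.isSubmodClosed.Build R (kZ x i)
  (@kcoboundary x i) (@kcoboundary_submod x i).

Definition koszulH x i : Type := quotmod (@kcoboundary x i).
HB.instance Definition _ x i := GRing.Lmodule.on (koszulH x i).

Definition xpow x t : 'I_d -> R := fun j => x j ^+ t.

(* Dual to the chain map e_j |-> x_j^(t - s) e_j from the Koszul complex of
   x^t to that of x^s. *)
Definition kmap0 x (s t : nat) (f : kcochain) : kcochain :=
  [ffun J : {set 'I_d} => (\prod_(j in J) x j ^+ (t - s)) *: f J].

Fact kmap0_linear x s t : linear (kmap0 x s t).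
Proof.
move=> a f g; apply/ffunP => J; rewrite !ffunE scalerDr !scalerA.
by rewrite mulrC.
Qed.

HB.instance Definition _ x s t :=
  GRing.isLinear.Build R kcochain kcochain *:%R (kmap0 x s t)
    (kmap0_linear x s t).

Fact kmap0_diff x s t f : (s <= t)%N ->
  kdiff (xpow x t) (kmap0 x s t f) = kmap0 x s t (kdiff (xpow x s) f).
Proof.
move=> le_st; apply/ffunP => J; rewrite !ffunE scaler_sumr.
apply: eq_bigr => j jJ; rewrite !ffunE !scalerA; congr (_ *: _).
rewrite (big_setD1 j jJ) /= /xpow -{1}(subnK le_st) exprD.
set S := _ ^+ #|_|; set P := \prod_(_ in _) _.
by rewrite [RHS]mulrACA [x j ^+ _ * S]mulrC [P * _]mulrC !mulrA.
Qed.

Fact kmapZ_subproof x s t i (f : kZ (xpow x s) i) : (s <= t)%N ->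
  kmap0 x s t (val f) \in kcocycle (xpow x t) i.
Proof.
move=> le_st; have /andP[/kdegP hf /eqP cf] := valP f; apply/andP; split.
  by apply/kdegP => J hJ; rewrite ffunE hf // scaler0.
by rewrite kmap0_diff // cf raddf0.
Qed.

Definition kmapZ x s t i (le_st : (s <= t)%N) (f : kZ (xpow x s) i) :
  kZ (xpow x t) i := Sub (kmap0 x s t (val f)) (kmapZ_subproof f le_st).

Definition kmap x i s t (le_st : (s <= t)%N) (h : koszulH (xpow x s) i) :
    koszulH (xpow x t) i :=
  quotmod_pi (@kcoboundary (xpow x t) i)
    (kmapZ le_st (quotmod_repr h)).

Definition kclass x i (f : kZ x i) : koszulH x i :=
  quotmod_pi (@kcoboundary x i) f.

Fact kmap_class x i s t (le_st : (s <= t)%N) (f : kZ (xpow x s) i) :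
  kmap le_st (kclass f) = kclass (kmapZ le_st f).
Proof.
apply/quotmod_piE.
have : quotmod_repr (kclass f) - f
    \in @kcoboundary (xpow x s) i.
  by apply/quotmod_piE; rewrite quotmod_pi_repr.
case/asboolP => g [hg eg]; apply/asboolP; exists (kmap0 x s t g); split.
  by move=> J hJ; rewrite ffunE hg // scaler0.
by rewrite raddfB /= -raddfB kmap0_diff // -eg [\val _]raddfB.
Qed.

Fact kclass_surj x i (h : koszulH x i) : exists f, h = kclass f.
Proof. by eexists; exact/esym/quotmod_pi_repr. Qed.

Fact kclass_linear x i : linear (@kclass x i).
Proof. exact: quotmod_pi_linear. Qed.

Fact kmap_linear x i s t (le_st : (s <= t)%N) : linear (@kmap x i s t le_st).
Proof.
move=> a p q; have [f ->] := kclass_surj p; have [g ->] := kclass_surj q.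
rewrite -kclass_linear !kmap_class -kclass_linear; congr kclass.
by apply: val_inj; rewrite linearP /= linearP.
Qed.

Fact kmap_id x i s (le_ss : (s <= s)%N) h : @kmap x i s s le_ss h = h.
Proof.
have [f ->] := kclass_surj h; rewrite kmap_class; congr kclass.
apply: val_inj; apply/ffunP => J; rewrite SubK ffunE subnn.
by rewrite big1 ?scale1r.
Qed.

Fact kmap_comp x i s t u (le_st : (s <= t)%N) (le_tu : (t <= u)%N)
    (le_su : (s <= u)%N) h :
  @kmap x i t u le_tu (kmap le_st h) = kmap le_su h.
Proof.
have [f ->] := kclass_surj h; rewrite !kmap_class; congr kclass.
apply: val_inj; apply/ffunP => J; rewrite !SubK !ffunE scalerA.
rewrite -big_split /=; congr (_ *: _); apply: eq_bigr => j _.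
by rewrite -exprD addnBA // subnK.
Qed.

(* The direct system t |-> H^i(x_1^(t+1), ..., x_d^(t+1); M). *)
Definition koszul_sys x i : dirsys R :=
  @DirSys R (fun t => koszulH (xpow x t.+1) i)
    (fun s t le_st => @kmap x i s.+1 t.+1 le_st)
    (fun s t le_st => @kmap_linear x i s.+1 t.+1 le_st)
    (fun s le_ss => @kmap_id x i s.+1 le_ss)
    (fun s t u le_st le_tu le_su =>
       @kmap_comp x i s.+1 t.+1 u.+1 le_st le_tu le_su).

Definition koszul_lim x i : lmodType R := dlim (koszul_sys x i).

(* x_j ^+ 1 is convertible to x_j. *)
Definition koszul_to_lim x i (h : koszulH x i) : koszul_lim x i :=
  @dlim_in R (koszul_sys x i) 0%N h.

End Koszul.

Section CommutativeAlgebra.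
Variable R : comNzRingType.

Definition noetherian : Prop := forall I : submodClosed R^o, fg_submod I.

Definition maximal_ideal (m : idealr R) : Prop :=
  forall I : idealr R, {subset m <= I} -> {subset I <= m}.

Definition local_ring (m : idealr R) : Prop :=
  maximal_ideal m /\ forall m' : idealr R, maximal_ideal m' -> m' =i m.

Definition finitely_generated (M : lmodType R) : Prop := fg_submod (@predT M).

Fixpoint ipow (q : {pred R}) (n : nat) : {pred R} :=
  if n is n'.+1 then imul q (ipow q n' : {pred R^o}) : {pred R^o} else predT.

Definition ideal_gen d (x : 'I_d -> R) : {pred R} :=
  span (fun a : R^o => exists i, a = x i).

Definition supp_chain (M : lmodType R) n (P : 'I_n.+1 -> prime_idealr R) :=
  (forall i a, (forall v : M, a *: v = 0) -> a \in P i) /\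
  (forall i j : 'I_n.+1, (i < j)%N -> @proper_sub R R^o (P i) (P j)).

(* dim M = dim R / Ann M; no n qualifies when M = 0. *)
Definition krull_dim (M : lmodType R) (n : nat) : Prop :=
  (exists P, @supp_chain M n P) /\
  forall k, (exists P, @supp_chain M k P) -> (k <= n)%N.

Definition regular_sequence (M : lmodType R) n (y : 'I_n -> R) : Prop :=
  (forall (i : 'I_n)
      (v : quotmod (imul [pred a | `[< exists2 j : 'I_n, (j < i)%N & a = y j >]]
                         (@predT M))),
     y i *: v = 0 -> v = 0) /\
  ~ (imul (ideal_gen y) (@predT M) =i predT).

Variable m : idealr R.

Definition is_depth (M : lmodType R) (n : nat) : Prop :=
  (exists2 y : 'I_n -> R, (forall i, y i \in m) & regular_sequence M y) /\
  forall k (y : 'I_k -> R),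
    (forall i, y i \in m) -> regular_sequence M y -> (k <= n)%N.

Definition cohen_macaulay (M : lmodType R) : Prop :=
  exists2 n, krull_dim M n & is_depth M n.

Definition system_of_parameters (M : lmodType R) d (x : 'I_d -> R) : Prop :=
  krull_dim M d /\
  (forall j, x j \in m) /\
  finite_length (quotmod (imul (ideal_gen x) (@predT M))).

Definition socle (L : lmodType R) : {pred L} :=
  fun z => `[< forall a, a \in m -> a *: z = 0 >].

Fact socle_submod L : submod_closed (@socle L).
Proof.
split=> [|a u v /asboolP hu /asboolP hv]; apply/asboolP => b bm.
  by rewrite scaler0.
by rewrite scalerDr scalerA mulrC -scalerA hu // hv // scaler0 addr0.
Qed.

HB.instance Definition _ L :=
  GRing.isSubmodClosed.Build R L (@socle L) (@socle_submod L).

(* The socle as a module over the residue field R / m. *)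
Definition soc (L : lmodType R) : Type := {z : L | z \in @socle L}.
HB.instance Definition _ L := SubChoice.on (soc L).
HB.instance Definition _ L := [SubChoice_isSubZmodule of soc L by <:].

Local Notation k := {ideal_quot m}.

Fact soc_scale_subproof L (c : k) (z : soc L) : repr c *: val z \in @socle L.
Proof. by rewrite rpredZ // (valP z). Qed.

Definition soc_scale L (c : k) (z : soc L) : soc L :=
  Sub (repr c *: val z) (soc_scale_subproof c z).

Fact soc_scaleE L (a : R) (c : k) (z : soc L) :
  c = \pi_k a -> val (soc_scale c z) = a *: val z.
Proof.
move=> ca; rewrite SubK; apply/eqP; rewrite -subr_eq0 -scalerBl; apply/eqP.
have /asboolP -> // := valP z.
by rewrite Quotient.idealrBE reprK ca eqxx.
Qed.

Fact soc_scaleA L a b (z : soc L) :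
  soc_scale a (soc_scale b z) = soc_scale (a * b) z.
Proof.
apply: val_inj; rewrite [RHS](@soc_scaleE _ (repr a * repr b)) ?rmorphM /= ?reprK //.
by rewrite -scalerA.
Qed.

Fact soc_scale1 L : left_id 1 (@soc_scale L).
Proof.
move=> z; apply: val_inj; rewrite (@soc_scaleE _ 1) ?scale1r //.
by rewrite rmorph1.
Qed.

Fact soc_scaleDr L : right_distributive (@soc_scale L) +%R.
Proof.
move=> a u v; apply: val_inj.
by rewrite -[LHS]/(repr a *: (\val u + \val v)) scalerDr.
Qed.

Fact soc_scaleDl L (z : soc L) : {morph (@soc_scale L)^~ z : a b / a + b}.
Proof.
move=> a b; apply: val_inj.
rewrite (@soc_scaleE _ (repr a + repr b)) ?rmorphD /= ?reprK //.
by rewrite scalerDl.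
Qed.

HB.instance Definition _ L := GRing.Zmodule_isLmodule.Build k (soc L)
  (@soc_scaleA L) (@soc_scale1 L) (@soc_scaleDr L) (@soc_scaleDl L).

End CommutativeAlgebra.

Definition has_dim (k : comNzRingType) (V : lmodType k) (n : nat) : Prop :=
  exists b : 'I_n -> V, forall v,
    exists! c : {ffun 'I_n -> k}, v = \sum_i c i *: b i.

(* 0 if V has no finite basis; socles of Artinian modules have one. *)
Definition basis_dim (k : comNzRingType) (V : lmodType k) : nat :=
  xget 0%N [set n | has_dim V n]%classic.

Definition soc_surjective (R : comNzRingType) (m : idealr R)
    (L L' : lmodType R) (f : L -> L') : Prop :=
  forall z, z \in @socle R m L' -> exists2 y, y \in @socle R m L & f y = z.

(* H^i_m(M), for M of dimension d, is the direct limit of the Koszul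
   cohomology modules H^i(x_1^t, ..., x_d^t; M), where x is any system of
   parameters of M: the modules koszul_lim M x i for different x are canonically
   isomorphic, and koszul_to_lim is the canonical map H^i(x; M) -> H^i_m(M).
   Choosing one x makes H^i_m(M) a single module, independent of the parameter
   ideals it is compared with. *)
Definition local_cohomology (R : comNzRingType) (m : idealr R)
    (M : lmodType R) (d i : nat) : lmodType R :=
  koszul_lim M
    (xget (fun _ => 0) [set x : 'I_d -> R | system_of_parameters m M x]%classic)
    i.

(* Main.v *)
(* Write q = (x_1, ..., x_d).  In top degree, Koszul cohomology is M / q M and its
   direct limit H^d_m(M) is the limit of the modules M / (x_1^t, ..., x_d^t) M under
   multiplication by x_1 ... x_d; moreover ir(N) = dim Soc (M / N) when M / N has
   finite length.  The pivot is the injectivity of M / q M -> H^d_m(M).  It allows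
   one to isolate coefficients in monomial relations: if the sum of the x^a v_a over
   |a| = n lies in q^(n+1) M, then all v_a are in q M.  With Krull's intersection
   theorem, x is then a regular sequence in any order; conversely regular sequences
   have the injectivity property.

   (iv) => (i): Soc (M / q M) -> Soc (H^d_m(M)) is surjective between spaces of equal
   dimension, hence injective, and M / q M, being of finite length, embeds in H^d_m(M).

   (i) => (ii): if d > 0, Soc (M / q^(n+1) M) lies in q^n M / q^(n+1) M, which is a direct sum
   of copies of M / q M indexed by the monomials of degree n.

   Two systems of parameters are connected by changes of one parameter at a time;
   such a change preserves regularity, and passing from a to a b induces an isomorphism
   of limits, so Soc (H^d_m(M)) may be computed from any system of parameters. *)

From HB Require Import structures.
From mathcomp Require Import all_boot all_order all_algebra.
From mathcomp Require classical_sets.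
From mathcomp Require Import boolp ring zify.
Require Import Defs.

Set Implicit Arguments.
Unset Strict Implicit.
Unset Printing Implicit Defensive.

Import GRing.Theory.
Local Open Scope ring_scope.

(** * Submodules and the ascending chain condition *)

(** Facts about [V / N] are phrased as membership in [N], so that iterated quotients are avoided,
    and finite length becomes [mprim], a condition on one element of [m] at a time. The injectivity
    of M / q M -> H^d_m(M) speaks of the single monomial (x_1 ... x_d)^t. It controls every
    coefficient of a relation because multiplication by a complementary monomial moves a chosen
    exponent to (t, ..., t), while each monomial that does not divide the chosen one becomes a
    multiple of some x_i^(t+1). The module H^d_m(M) is built from one system, whereas the conditions
    concern all systems. No evident map relates the powers of x_i to those of another parameter c,
    but both limits are isomorphic to the one for the product x_i c. Prime avoidance provides a c
    that fits into two given systems at once. Dimensions have the default value 0, so the equality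
    in (iv) becomes informative only once M / q M is known to be nonzero. *)

Section Submodules.
Variables (R : comNzRingType) (V : lmodType R).
Implicit Types (N D : submodClosed V) (u v w : V) (a b c : R).

Lemma submodN N u : u \in N -> - u \in N.
Proof. by move=> uN; rewrite -scaleN1r rpredZ. Qed.

Lemma submodB N u v : u \in N -> v \in N -> u - v \in N.
Proof. by move=> uN vN; rewrite rpredD ?submodN. Qed.

Lemma submod_addl N u v : u \in N -> (u + v \in N) = (v \in N).
Proof.
move=> uN; apply/idP/idP => [h|]; last exact: rpredD.
by rewrite -[v](addKr u) rpredD ?submodN.
Qed.

Definition is_submod (P : V -> Prop) : Prop :=
  P 0 /\ forall a u v, P u -> P v -> P (a *: u + v).

Definition mkset P (h : is_submod P) : {pred V} := fun v => `[< P v >].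

Fact mkset_submod P (h : is_submod P) : submod_closed (mkset h).
Proof.
case: {+}h => h0 h1; split=> [|a u v /asboolP Pu /asboolP Pv]; apply/asboolP=> //.
exact: h1.
Qed.

HB.instance Definition _ P (h : is_submod P) :=
  GRing.isSubmodClosed.Build R V (mkset h) (mkset_submod h).

Lemma span_ind (S P : V -> Prop) v :
  is_submod P -> (forall u, S u -> P u) -> v \in span S -> P v.
Proof.
move=> h SP /asboolP/(_ (mkset h : submodClosed V)) H.
by apply/asboolP/H => u /SP Pu; apply/asboolP.
Qed.

Lemma mem_span (S : V -> Prop) v : S v -> v \in span S.
Proof. by move=> Sv; apply/asboolP => N; apply. Qed.

Lemma span_sub (S : V -> Prop) N :
  (forall u, S u -> u \in N) -> {subset span S <= N}.
Proof. by move=> SN v /asboolP; apply. Qed.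

(** Many submodules below are written as the span of their own set of elements, which makes them
    terms of [submodClosed] at once; this gives back the membership condition. *)
Lemma spanP P v : is_submod P -> v \in span P <-> P v.
Proof. by move=> h; split=> [/span_ind|/mem_span //]; apply. Qed.

Definition addm N a : submodClosed V :=
  span (fun v => exists n u, n \in N /\ v = n + a *: u).

Lemma addmP N a v :
  v \in addm N a <-> exists n u, n \in N /\ v = n + a *: u.
Proof.
apply: spanP; split=> [|c _ _ [n [u [nN ->]]] [n' [u' [n'N ->]]]].
  by exists 0, 0; rewrite rpred0 scaler0 addr0.
exists (c *: n + n'), (c *: u + u'); rewrite rpredD ?rpredZ //; split=> //.
by rewrite !scalerDr addrACA !scalerA [a * c]mulrC.
Qed.

Lemma addml N a v : v \in N -> v \in addm N a.
Proof. by move=> vN; apply/addmP; exists v, 0; rewrite scaler0 addr0. Qed.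

Lemma addmr N a v : a *: v \in addm N a.
Proof. by apply/addmP; exists 0, v; rewrite rpred0 add0r. Qed.

Lemma addm_mono N D a : {subset N <= D} -> {subset addm N a <= addm D a}.
Proof.
by move=> ND _ /addmP[n [u [/ND nD ->]]]; apply/addmP; exists n, u.
Qed.

Definition addv N w : submodClosed V :=
  span (fun v => exists n a, n \in N /\ v = n + a *: w).

Lemma addvP N w v :
  v \in addv N w <-> exists n a, n \in N /\ v = n + a *: w.
Proof.
apply: spanP; split=> [|c _ _ [n [a [nN ->]]] [n' [b [n'N ->]]]].
  by exists 0, 0; rewrite rpred0 scale0r addr0.
exists (c *: n + n'), (c * a + b); rewrite rpredD ?rpredZ //; split=> //.
by rewrite scalerDr scalerDl addrACA !scalerA.
Qed.

Lemma addvl N w v : v \in N -> v \in addv N w.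
Proof. by move=> vN; apply/addvP; exists v, 0; rewrite scale0r addr0. Qed.

Lemma addvr N w : w \in addv N w.
Proof. by apply/addvP; exists 0, 1; rewrite rpred0 add0r scale1r. Qed.

Definition addS N D : submodClosed V :=
  span (fun v => exists n u, [/\ n \in N, u \in D & v = n + u]).

Lemma addSP N D v :
  v \in addS N D <-> exists n u, [/\ n \in N, u \in D & v = n + u].
Proof.
apply: spanP; split=> [|c _ _ [n [u [nN uD ->]]] [n' [u' [n'N u'D ->]]]].
  by exists 0, 0; rewrite !rpred0 addr0.
exists (c *: n + n'), (c *: u + u'); rewrite !rpredD ?rpredZ //; split=> //.
by rewrite !scalerDr addrACA.
Qed.

Lemma addSl N D v : v \in N -> v \in addS N D.
Proof. by move=> vN; apply/addSP; exists v, 0; rewrite rpred0 addr0. Qed.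

Lemma addSr N D v : v \in D -> v \in addS N D.
Proof. by move=> vN; apply/addSP; exists 0, v; rewrite rpred0 add0r. Qed.

Definition capS N D : submodClosed V := span (fun v => v \in N /\ v \in D).

Lemma capSP N D v : v \in capS N D <-> v \in N /\ v \in D.
Proof.
by apply: spanP; split=> [|c u w [? ?] [? ?]]; rewrite ?rpred0 // !rpredD ?rpredZ.
Qed.

Definition colon N a : submodClosed V := span (fun v => a *: v \in N).

Lemma colonP N a v : v \in colon N a <-> a *: v \in N.
Proof.
apply: (@spanP (fun v => a *: v \in N)).
split=> [|c u w ? ?]; rewrite ?scaler0 ?rpred0 //.
by rewrite scalerDr scalerA mulrC -scalerA rpredD // rpredZ.
Qed.

(** The annihilator of [V / N]; [annelt] is that of the class of a single element. *)
Definition annquot N : submodClosed R^o := span (fun a : R^o => forall v, a *: v \in N).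

Definition annelt N v : submodClosed R^o := span (fun a : R^o => a *: v \in N).

Definition lspan (s : seq V) : submodClosed V := span (fun v => v \in s).

Lemma lspan_mono (s t : seq V) : {subset s <= t} -> {subset lspan s <= lspan t}.
Proof. by move=> st; apply: span_sub => u /st ut; apply: mem_span. Qed.

Lemma lspan_cons (a0 : V) s v :
  v \in lspan (a0 :: s) <-> exists c w, w \in lspan s /\ v = c *: a0 + w.
Proof.
split=> [|[c [w [ws ->]]]].
  apply: (@span_ind _ (fun v => exists c w, w \in lspan s /\ v = c *: a0 + w)) => [|u];
    first split=> [|c _ _ [x [w [ws ->]]] [x' [w' [w's ->]]]].
  - by exists 0, 0; rewrite rpred0 scale0r addr0.
  - exists (c * x + x'), (c *: w + w'); rewrite rpredD ?rpredZ //; split=> //.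
    by rewrite scalerDr scalerDl addrACA !scalerA.
  rewrite inE => /predU1P[->|us].
    by exists 1, 0; rewrite rpred0 scale1r addr0.
  by exists 0, u; rewrite scale0r add0r; split=> //; apply: mem_span.
rewrite rpredD //; first by apply/rpredZ/mem_span; rewrite mem_head.
by apply: span_sub ws => u us; apply: mem_span; rewrite inE us orbT.
Qed.

End Submodules.

Lemma annquotP (R : comNzRingType) (V : lmodType R) (N : submodClosed V) (a : R) :
  a \in annquot N <-> forall v, a *: v \in N.
Proof.
apply: (@spanP R R^o (fun b : R => forall v, b *: v \in N)); split=> [v|c u w hu hw v];
    first by rewrite scale0r rpred0.
by rewrite scalerDl -scalerA rpredD // rpredZ.
Qed.

Lemma anneltP (R : comNzRingType) (V : lmodType R) (N : submodClosed V) v (a : R) :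
  a \in annelt N v <-> a *: v \in N.
Proof.
apply: (@spanP R R^o (fun b : R => b *: v \in N)); split=> [|c u w hu hw]; first by
    rewrite scale0r rpred0.
by rewrite scalerDl -scalerA rpredD // rpredZ.
Qed.

Section Noetherian.
Variable R : comNzRingType.

(** The maximal condition is the form in which finiteness is used: nearly every argument takes a
    maximal submodule with some property, or a maximal counterexample. *)
Definition noethmod (V : lmodType R) : Prop :=
  forall F : submodClosed V -> Prop, (exists N, F N) ->
  exists N, F N /\ forall N', F N' -> {subset N <= N'} -> {subset N' <= N}.

Lemma fg_lspan (V : lmodType R) (N : {pred V}) : fg_submod N ->
  exists s, N =i lspan s.
Proof.
case=> n [b hb]; exists (codom b) => v; rewrite hb.
apply/idP/idP; apply: span_sub => u.
  by case=> i ->; apply/mem_span/codom_f.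
by case/codomP => i ->; apply: mem_span; exists i.
Qed.

(** The coefficients of [a0] in elements of [N] form an ideal. Lifts to [N] of its finitely many
    generators reduce each element of [N] to one in the span of [s], where induction applies. *)
Lemma lspan_noeth (V : lmodType R) (s : seq V) (N : submodClosed V) :
  noetherian R -> {subset N <= lspan s} -> exists t, N =i lspan t.
Proof.
move=> noethR; elim: s N => [|a0 s IH] N sub.
  exists [::] => v; apply/idP/idP => [/sub //|]; exact: span_sub.
have [t' ht'] := IH (capS N (lspan s)) (fun v h => (proj1 (capSP _ _ v) h).2).
pose I : submodClosed R^o :=
  span (fun c : R^o => exists w, w \in lspan s /\ c *: a0 + w \in N).
have IP (c : R) : c \in I <-> exists w, w \in lspan s /\ c *: a0 + w \in N.
  apply: (@spanP R R^o (fun c : R => exists w, w \in lspan s /\ c *: a0 + w \in N)).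
  split=> [|e x y [w [ws wN]] [w' [w's w'N]]].
    by exists 0; rewrite scale0r addr0 !rpred0.
  exists (e *: w + w'); rewrite rpredD ?rpredZ //; split=> //.
  by rewrite scalerDl addrACA -scalerA -scalerDr rpredD ?rpredZ.
have [n [b hb]] := noethR I.
have /choice[f hf] i : exists w, w \in lspan s /\ b i *: a0 + w \in N.
  by apply/IP; rewrite hb; apply: mem_span; exists i.
pose L := codom (fun i => b i *: a0 + f i).
exists (L ++ t') => v; apply/idP/idP; last first.
  apply: span_sub => u; rewrite mem_cat => /orP[/codomP[i ->]|ut'].
    exact: (hf i).2.
  by have /capSP[] : u \in capS N (lspan s) by rewrite ht'; apply: mem_span.
move=> vN; have /lspan_cons[c [w [ws ev]]] := sub v vN.
have cI : c \in I by apply/IP; exists w; rewrite -ev.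
have [u [uL us]] : exists u, u \in lspan L /\ u - c *: a0 \in lspan s.
  move: cI; rewrite hb.
  apply: (@span_ind _ R^o _ (fun c : R => exists u, u \in lspan L /\ u - c *: a0 \in
      lspan s)).
    split=> [|e x y [u [uL us]] [u' [u'L u's]]].
      by exists 0; rewrite scale0r subr0 !rpred0.
    exists (e *: u + u'); rewrite rpredD ?rpredZ //; split=> //.
    rewrite scalerDl opprD addrACA -scalerA -scalerBr.
    by rewrite rpredD ?rpredZ.
  move=> _ [i ->]; exists (b i *: a0 + f i); split.
    by apply/mem_span/codomP; exists i.
  by rewrite addrC addKr (hf i).1.
have LN : {subset lspan L <= N}.
  by apply: span_sub => _ /codomP[i ->]; apply: (hf i).2.
have /= : v - u \in lspan t'.
  rewrite -ht'; apply/capSP; split; first by rewrite submodB // LN.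
  by rewrite ev [c *: a0 + w]addrC -addrA -opprB submodB.
rewrite -{2}[v](subrK u) => vu; rewrite rpredD //.
  by apply: lspan_mono vu => x; rewrite mem_cat orbC => ->.
by apply: lspan_mono uL => x; rewrite mem_cat => ->.
Qed.

Lemma noethmodP (V : lmodType R) :
  noetherian R -> finitely_generated V -> noethmod V.
Proof.
move=> noethR /fg_lspan[s hs] F exF; apply: contrapT => nomax.
have step (N : {N | F N}) : exists N' : {N | F N},
    {subset sval N <= sval N'} /\ ~ {subset sval N' <= sval N}.
  apply: contrapT => hN; apply: nomax; exists (sval N); split; first exact: svalP.
  move=> N' FN' sub; apply: contrapT => nsub; apply: hN.
  by exists (exist _ N' FN').
have [g hg] := choice step; have [N0 FN0] := exF.
pose G k : {N | F N} := iter k g (exist _ N0 FN0).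
have Gle k j : (k <= j)%N -> {subset sval (G k) <= sval (G j)}.
  move=> /subnK <-; elim: (j - k)%N => [|i IH] v // /IH; exact: (hg _).1.
pose U : submodClosed V := span (fun v => exists k, v \in sval (G k)).
have UP v : v \in U <-> exists k, v \in sval (G k).
  apply: spanP; split=> [|a u w [k hk] [j hj]]; first by exists 0%N; rewrite rpred0.
  exists (maxn k j); rewrite rpredD ?rpredZ //.
    exact: Gle (leq_maxl _ _) _ hk.
  exact: Gle (leq_maxr _ _) _ hj.
have [t ht] : exists t, U =i lspan t.
  by apply: (@lspan_noeth _ s) => // v _; rewrite -hs.
have [K hK] : exists K, forall v, v \in t -> v \in sval (G K).
  have : forall v, v \in t -> exists k, v \in sval (G k).
    by move=> v vt; apply/UP; rewrite ht; apply: mem_span.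
  elim: (t) => [|a t' IH] h; first by exists 0%N.
  have [k hk] := h a (mem_head _ _).
  have [|K hK] := IH; first by move=> v vt; apply: h; rewrite inE vt orbT.
  exists (maxn k K) => v; rewrite inE => /predU1P[->|vt].
    exact: Gle (leq_maxl _ _) _ hk.
  exact: Gle (leq_maxr _ _) _ (hK v vt).
apply: (hg (G K)).2 => v vg; have : v \in U by apply/UP; exists K.+1.
by rewrite ht; apply: span_sub.
Qed.

Lemma noethmod_ring : noetherian R -> noethmod R^o.
Proof.
move=> nR; apply: noethmodP => //.
have [n [b hb]] := nR (@span R R^o (fun=> True)); exists n, b => v.
by rewrite -hb inE; apply/esym/mem_span.
Qed.

End Noetherian.

(** * Prime ideals and local rings *)

Section PrimeIdeals.
Variable R : comNzRingType.
Implicit Types (I P Q : submodClosed R^o) (a b : R).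

Lemma idealM I a b : b \in I -> a * b \in I.
Proof. exact: (@rpredZ R R^o I a b). Qed.

Definition isprime P : Prop :=
  1 \notin P /\ forall a b, a * b \in P -> a \in P \/ b \in P.

Lemma isprimeX P a n : isprime P -> a ^+ n \in P -> a \in P.
Proof.
move=> [P1 PM]; elim: n => [|n IH]; first by rewrite expr0 (negPf P1).
by rewrite exprS => /PM[].
Qed.

(** An ideal maximal among those above [I] that miss [S] is prime: adjoining an outside element
    makes it meet [S], and if [a] and [b] are both outside, the product of the two elements of [S]
    so obtained lies in the ideal as soon as [a * b] does. *)
Lemma exists_prime (S : R -> Prop) I : noethmod R^o ->
  S 1 -> (forall a b, S a -> S b -> S (a * b)) -> (forall a, S a -> a \notin I) ->
  exists P, [/\ isprime P, {subset I <= P} & forall a, S a -> a \notin P].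
Proof.
move=> noethR S1 SM SI.
have [|P [[IP SP] maxP]] := noethR (fun P : submodClosed R^o => {subset I <= P} /\
  forall a, S a -> a \notin P); first by exists I; split.
exists P; split=> //; split=> [|a b abP]; first exact: SP.
have enl (c : R) : c \notin P -> exists s r : R, S s /\ s - r * c \in P.
  move=> cP; apply: contrapT => no; move/negP: cP; apply.
  apply: (maxP (addv P (c : R^o))) => [|u|]; last exact: addvr; last exact: addvl.
  split=> [u /IP|s Ss]; first exact: addvl.
  apply/negP => /addvP[p [r [pP e]]]; apply: no; exists s, r.
  by split=> //; rewrite e addrK.
case: (boolP (a \in P)) => [|/enl[s [r [Ss sP]]]]; first by left.
case: (boolP (b \in P)) => [|/enl[t [r' [St tP]]]]; first by right.
exfalso; move/negP: (SP _ (SM _ _ Ss St)); apply.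
have -> : s * t = t * (s - r * a) + (r * a) * (t - r' * b) + (r * r') * (a * b).
  by ring.
by rewrite !(@rpredD _ P) //; apply: idealM.
Qed.

Lemma exists_prime_pow I a : noethmod R^o -> (forall k, a ^+ k \notin I) ->
  exists P, [/\ isprime P, {subset I <= P} & a \notin P].
Proof.
move=> noethR h.
have [|_ _ [i ->] [j ->]|_ [k ->] //|P [pP IP SP]] :=
    @exists_prime (fun b => exists k, b = a ^+ k) I noethR.
- by exists 0%N.
- by exists (i + j)%N; rewrite exprD.
by exists P; split=> //; apply: SP; exists 1%N.
Qed.

(** Arguments run on [submodClosed R^o]; this packaging is for [maximal_ideal] and [supp_chain],
    which quantify over [idealr] and [prime_idealr]. *)
Definition ideal_of I (h : 1 \notin I) : {pred R} := I.

Fact ideal_of_closed I (h : 1 \notin I) : idealr_closed (ideal_of h).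
Proof.
split=> [|//|a u v uI vI]; first exact: (@rpred0 _ I).
exact: (@rpredD _ I _ _ (idealM a uI) vI).
Qed.

HB.instance Definition _ I (h : 1 \notin I) :=
  isIdealr.Build R (ideal_of h) (@ideal_of_closed I h).

Definition prime_of P (h : isprime P) : {pred R} := ideal_of h.1.

HB.instance Definition _ P (h : isprime P) := Idealr.on (prime_of h).

Fact prime_of_closed P (h : isprime P) : prime_idealr_closed (prime_of h).
Proof. by move=> u v uv; case: (h.2 u v uv) => ->; rewrite ?orbT. Qed.

HB.instance Definition _ P (h : isprime P) :=
  isPrimeIdealrClosed.Build R (prime_of h) (@prime_of_closed P h).

Definition ideal_sub (I : idealr R) : submodClosed R^o :=
  span (fun a : R^o => a \in I).

Lemma ideal_subP (I : idealr R) a : a \in ideal_sub I <-> a \in I.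
Proof.
apply: (@spanP R R^o (fun a : R => a \in I)).
by split=> [|c u v uI vI]; rewrite ?rpred0 // rpredD // idealMr.
Qed.

End PrimeIdeals.

(** * Nakayama's lemma, finite length and exchange of parameters *)

Section LocalRing.
Variables (R : comNzRingType) (m : idealr R).

(* [V / N] is supported at [m]; when [V] is finitely generated this means that
   [V / N] has finite length. *)
Definition mprim (V : lmodType R) (N : submodClosed V) : Prop :=
  forall a, a \in m -> exists k, forall v, a ^+ k *: v \in N.

Definition nzd (V : lmodType R) (N : submodClosed V) (a : R) : Prop :=
  forall v, a *: v \in N -> v \in N.

Hypotheses (noethR : noethmod R^o) (localR : local_ring m).

(** Otherwise the multiples of [a] lie in a maximal proper ideal, which is [m] because the ring is
    local. *)
Lemma local_unit a : a \notin m -> exists b, b * a = 1.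
Proof.
move=> am; apply: contrapT => nb.
pose A : submodClosed R^o := span (fun b : R^o => exists c, b = c * a).
have AP (b : R) : b \in A <-> exists c, b = c * a.
  apply: (@spanP R R^o (fun b : R => exists c, b = c * a)).
  split=> [|e _ _ [c ->] [c' ->]]; first by exists 0; rewrite mul0r.
  by exists (e * c + c'); rewrite mulrDl -mulrA.
have [|I [[I1 AI] maxI]] := noethR
    (F := fun I => 1 \notin I /\ {subset A <= I}).
  by exists A; split=> //; apply/negP => /AP[c e]; apply: nb; exists c.
have maxI' : maximal_ideal (ideal_of I1).
  move=> J IJ x xJ; apply: (maxI (ideal_sub J)); last exact/ideal_subP.
    split; first by apply/negP => /ideal_subP; rewrite idealr1.
    by move=> y /AI yI; apply/ideal_subP/IJ.
  by move=> y yI; apply/ideal_subP/IJ.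
move/negP: am; apply; rewrite -(localR.2 _ maxI').
by apply/AI/AP; exists 1; rewrite mul1r.
Qed.

Lemma mprime_sub (P : submodClosed R^o) : isprime P -> {subset P <= m}.
Proof.
move=> [P1 _] a aP; apply: contraNT P1 => /local_unit[b <-]; exact: idealM.
Qed.

Variable V : lmodType R.
Hypothesis noethV : noethmod V.
Implicit Types (N D B : submodClosed V) (a x : R).

Lemma m1subr_unit a : a \in m -> exists c : R, c * (1 - a) = 1.
Proof.
move=> am; apply: local_unit; apply/negP => h.
by have := rpredD h am; rewrite subrK idealr1.
Qed.

(* For [N'] maximal among the submodules above [N] that do not contain [D], any
   [v] in [D] outside [N'] satisfies [D <= N' + R v], so [v] is in [N' + m v]. *)
Lemma nakayama N D :
  (forall v, v \in D -> v \in addS N (imul m D)) -> {subset D <= N}.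
Proof.
move=> DN; apply: contrapT => nDN.
have [|N' [[NN' nDN'] maxN']] := noethV
    (F := fun N' => {subset N <= N'} /\ ~ {subset D <= N'}); first by exists N; split.
apply: nDN' => v vD; apply: contrapT => /negP vN'.
have DNv : {subset D <= addv N' v}.
  apply: contrapT => nD; move/negP: vN'; apply.
  apply: (maxN' (addv N' v)) => [|u|]; last exact: addvr; last exact: addvl.
  by split=> // u /NN'; exact: addvl.
have /addSP[n [w [nN wD ev]]] := DN v vD.
have : exists n' a, [/\ n' \in N', a \in m & w = n' + a *: v].
  apply: (span_ind (P := fun w => exists n' a, [/\ n' \in N', a \in m & w = n' + a *:
      v]) _ _ wD).
    split=> [|c _ _ [n1 [a [n1N am ->]]] [n2 [r [n2N rm ->]]]].
      by exists 0, 0; rewrite !rpred0 scale0r addr0.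
    exists (c *: n1 + n2), (c * a + r); split; first by rewrite rpredD ?rpredZ.
      by rewrite rpredD ?idealMr.
    by rewrite scalerDr scalerDl addrACA !scalerA.
  move=> _ [a [u [am /DNv/addvP[n1 [r [n1N ->]]] ->]]].
  exists (a *: n1), (a * r); rewrite rpredZ // mulrC idealMr //; split=> //.
  by rewrite scalerDr scalerA mulrC.
move=> [n' [a [n'N am ew]]]; have [r eb] := m1subr_unit am.
have : (1 - a) *: v \in N'.
  by rewrite scalerBl scale1r {1}ev ew addrA addrK rpredD // NN'.
move/(@rpredZ _ _ N' r); rewrite scalerA eb scale1r => vN.
by rewrite vN in vN'.
Qed.

Lemma colon_stable N a :
  exists n, forall k v, a ^+ k *: v \in N -> a ^+ n *: v \in N.
Proof.
have [|_ [[n ->] maxN]] := noethV (F := fun C => exists n, C = colon N (a ^+ n)).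
  by exists (colon N (a ^+ 0)), 0%N.
have mono i j : (i <= j)%N -> {subset colon N (a ^+ i) <= colon N (a ^+ j)}.
  move=> /subnK <- v /colonP h; apply/colonP.
  by rewrite exprD -scalerA rpredZ.
exists n => k v h; have [kn|/ltnW nk] := leqP k n.
  by apply/colonP/(mono _ _ kn)/colonP.
by apply/colonP/(maxN (colon N (a ^+ k))); [exists k|exact: mono|exact/colonP].
Qed.

Lemma mprim_sub N N' : {subset N <= N'} -> mprim N -> mprim N'.
Proof. by move=> NN' h a /h[k hk]; exists k => v; apply/NN'. Qed.

(** Take a multiple of [w] outside [B] whose annihilator modulo [B] is maximal. For [a] in [m], its
    last multiple by a power of [a] that is still outside [B] has an annihilator containing both the
    former one and [a]; by maximality the two agree. *)
Lemma socle_elt B w : mprim B -> w \notin B ->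
  exists c, c *: w \notin B /\ forall a, a \in m -> a *: (c *: w) \in B.
Proof.
move=> hB wB.
have [|_ [[c [cwB ->]] maxI]] := noethR (F := fun I : submodClosed R^o =>
    exists c, c *: w \notin B /\ I = annelt B (c *: w)).
  by exists (annelt B (1 *: w)), 1; rewrite scale1r.
exists c; split=> // a am; have [k hk] := hB a am.
have [j jB] : exists j, a ^+ j *: (c *: w) \notin B /\ a ^+ j.+1 *: (c *: w) \in B.
  move: (hk (c *: w)); elim: k {hk} => [|k IH h]; first by rewrite expr0 scale1r (negPf
      cwB).
  by case: (boolP (a ^+ k *: (c *: w) \in B)) => [/IH //|?]; exists k.
apply/anneltP/(maxI (annelt B ((a ^+ j * c) *: w))).
- by exists (a ^+ j * c); rewrite -[(_ * c) *: w]scalerA jB.1.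
- move=> r /anneltP rB; apply/anneltP.
  have -> : (r : R) *: ((a ^+ j * c) *: w) = a ^+ j *: (r *: (c *: w)).
    by rewrite !scalerA mulrCA mulrA.
  exact: rpredZ.
apply/anneltP; by have := jB.2; rewrite !scalerA exprS mulrA.
Qed.

(* Herstein's argument: a submodule [C] maximal with [C :&: D = N + m D] contains
   [a ^+ n *: V] for [n] large, for every [a] in [m]. *)
Lemma krull_intersection N (D : submodClosed V) :
  {subset N <= D} ->
  (forall C : submodClosed V, {subset N <= C} -> mprim C -> {subset D <= C}) ->
  {subset D <= N}.
Proof.
move=> ND hD; apply: nakayama; set E := addS N (imul m D).
have ED : {subset E <= D}.
  move=> _ /addSP[n [u [/ND nD uD ->]]]; rewrite rpredD //.
  by apply: span_sub uD => _ [a [w [_ wD ->]]]; apply: rpredZ.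
have [|C [[EC CDE] maxC]] := noethV (F := fun C => {subset E <= C} /\
    forall v, v \in C -> v \in D -> v \in E); first by exists E; split.
have Cprim : mprim C.
  move=> a am; have [n hn] := colon_stable C a; exists n => v.
  apply: (maxC (addm C (a ^+ n))) => [|u|]; last exact: addmr; last exact: addml.
  split=> [u /EC|_ /addmP[c [u [cC ->]]] dD]; first exact: addml.
  have : a *: (c + a ^+ n *: u) \in E.
    by apply/addSr/mem_span; exists a, (c + a ^+ n *: u).
  move=> /EC; rewrite scalerDr (submod_addl _ (rpredZ a cC)) scalerA -exprS => /hn uC.
  by apply: CDE => //; rewrite rpredD.
by move=> v vD; apply: CDE => //; apply: hD => // u uN; apply/EC/addSl.
Qed.

(** The length of [V / N] is at most [b], read off the chains of submodules of [V] above [N]. *)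
Definition chain_bound N b : Prop := forall n (K : 'I_n.+1 -> submodClosed V),
  (forall i, {subset N <= K i}) ->
  (forall i j : 'I_n.+1, (i < j)%N -> proper_sub (K i) (K j)) -> (n <= b)%N.

(** Modulo [N] the element [w] spans a module of length at most one, so adding [w] to all members of
    a chain above [N] costs at most one step. *)
Lemma chain_bound_addv N w b : (forall a, a \in m -> a *: w \in N) ->
  chain_bound (addv N w) b -> chain_bound N b.+1.
Proof.
move=> mw hb [//|n] K NK chK; rewrite ltnS.
(* The member to be dropped: the first one that contains [w], or the last one if none does. *)
have [i [hi hi']] : exists i : 'I_n.+2,
    (forall p : 'I_n.+2, (p < i)%N -> w \notin K p) /\ (i = ord_max \/ w \in K i).
  case: (pickP [pred i | w \in K i]) => [i0 wi0|h].
    case: (arg_minnP (fun i : 'I__ => i : nat) wi0) => i wi mini.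
    exists i; split=> [p pi|]; last by right.
    by apply/negP => /mini; rewrite leqNgt pi.
  by exists ord_max; split=> [p _|]; [exact/negbT/h|left].
have wK (p : 'I_n.+2) : (i < p)%N -> w \in K i.
  case: hi' => [->|//]; by rewrite ltnNge -ltnS ltn_ord.
have mono (p q : 'I_n.+2) : (p <= q)%N -> {subset K p <= K q}.
  by rewrite leq_eqVlt => /predU1P[/val_inj -> //|/chK[]].
apply: (hb n (fun j => addv (K (lift i j)) w)) => [j v /addvP[u [a [uN ->]]]|j j' jj'].
  by rewrite rpredD //; [apply/addvl/NK|apply/rpredZ/addvr].
set p := lift i j; set q := lift i j'.
have pq : (p < q)%N.
  by rewrite /p /q /= /bump; case: leqP; case: leqP; lia.
have pi : p != i by rewrite eq_sym neq_lift.
have qi : q != i by rewrite eq_sym neq_lift.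
have [sub nsub] := chK p q pq; split.
  move=> v /addvP[u [a [uK ->]]].
  by rewrite rpredD //; [apply/addvl/sub|apply/rpredZ/addvr].
move=> subw; have [qltp|pleq] := ltnP q i.
  have [u [uKq /negP uKp]] : exists u, u \in K q /\ u \notin K p.
    by apply: contrapT => no; apply: nsub => u uq; apply: contrapT => /negP up;
      apply: no; exists u.
  have /subw/addvP[v [a [vK eu]]] := addvl w uKq.
  case: (boolP (a \in m)) => am.
    by apply: uKp; rewrite eu rpredD //; apply/NK/mw.
  have [b' eb] := local_unit am; move/negP: (hi q qltp); apply.
  rewrite -[w]scale1r -eb -scalerA rpredZ // -(addKr v (a *: w)) -eu.
  by rewrite rpredD // submodN // sub.
have iq : (i < q)%N by rewrite ltn_neqAle eq_sym qi pleq.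
have wi := wK q iq; have [_ niq] := chK i q iq.
case: (ltngtP p i) => [pltp|ip|/val_inj e]; last by rewrite e eqxx in pi.
  apply: niq => u /(addvl w)/subw/addvP[v [a [vK ->]]].
  by rewrite rpredD ?rpredZ //; apply: (mono p) => //; exact: ltnW.
apply: nsub => u /(addvl w)/subw/addvP[v [a [vK ->]]].
by rewrite rpredD ?rpredZ //; apply: (mono i) => //; exact: ltnW.
Qed.

(** A maximal [B] without a bound could be enlarged by a socle element of [V / B], which changes the
    bound by one only. *)
Lemma chain_bound_mprim N : mprim N -> exists b, chain_bound N b.
Proof.
move=> hN; apply: contrapT => nb.
have [|B [[hB nB] maxB]] := noethV (F := fun B => mprim B /\ ~ exists b, chain_bound B
    b).
  by exists N.
have [w wB] : exists w, w \notin B.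
  apply: contrapT => no; apply: nB; exists 0%N => [[//|n] K BK chK].
  have [|_ []] := chK ord0 ord_max; first by [].
  move=> v _; apply: BK; apply: contrapT => /negP vB; apply: no.
  by exists v.
have [c [cwB mcw]] := socle_elt hB wB.
have [b hb] : exists b, chain_bound (addv B (c *: w)) b.
  apply: contrapT => no; move/negP: cwB; apply.
  apply: (maxB (addv B (c *: w))) => [|u|]; last exact: addvr; last exact: addvl.
  by split=> //; apply: mprim_sub hB => u; exact: addvl.
by apply: nB; exists b.+1; apply: chain_bound_addv hb.
Qed.

Lemma dcc N b (G : nat -> submodClosed V) : chain_bound N b ->
  (forall n, {subset N <= G n}) -> (forall n, {subset G n.+1 <= G n}) ->
  exists n, {subset G n <= G n.+1}.
Proof.
move=> hb NG Gdec; apply: contrapT => no.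
have mono i j : (i <= j)%N -> {subset G j <= G i}.
  by move=> /subnK <-; elim: (j - i)%N => [|k IH] v // /Gdec /IH.
suff: (b.+1 <= b)%N by rewrite ltnn.
apply: (hb b.+1 (fun i => G (b.+1 - i)%N)) => // i j ij.
have jb : (j <= b.+1)%N by rewrite -ltnS ltn_ord.
have ib : (i <= b.+1)%N by rewrite -ltnS ltn_ord.
split; first by apply: mono; lia.
move=> sub; apply: no; exists (b.+1 - j)%N => v /sub; apply: mono; lia.
Qed.

(** If the length is finite, the decreasing submodules [addm N (a ^+ n)] become stationary and
    Nakayama's lemma places them in [N]. The converse transports [chain_bound_mprim] along the
    correspondence between submodules of the quotient and submodules above [N]. *)
Lemma finite_lengthP N : finite_length (quotmod N) <-> mprim N.
Proof.
split=> [[b hb] a am|/chain_bound_mprim[b hb]].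
  have hN : chain_bound N b.
    move=> n K NK chK.
    pose L i : submodClosed (quotmod N) := span (fun q => exists2 v, v \in K i & q =
        quotmod_pi N v).
    have LP i v : quotmod_pi N v \in L i <-> v \in K i.
      split=> [|vK]; last by apply: mem_span; exists v.
      have : is_submod (fun q => exists2 v, v \in K i & q = quotmod_pi N v).
        split=> [|c _ _ [u uK ->] [u' u'K ->]]; first by exists 0; rewrite ?rpred0
            ?raddf0.
        by exists (c *: u + u'); rewrite ?rpredD ?rpredZ // linearP.
      move=> sm /(iffLR (spanP (quotmod_pi N v) sm))[u uK /quotmod_piE/(NK i) vu].
      rewrite -[v](subrK u); exact: rpredD.
    apply: (hb n L) => i j ij; have [sub nsub] := chK i j ij; split=> [q|sub'].
      by rewrite -[q]quotmod_pi_repr => /LP/sub h; apply/LP.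
    by apply: nsub => v /LP/sub'/LP.
  have [||n hn] := dcc (G := fun n => addm N (a ^+ n)) hN.
  - by move=> n u; exact: addml.
  - move=> n _ /addmP[u [v [uN ->]]]; apply/addmP; exists u, (a *: v).
    by rewrite scalerA -exprSr.
  exists n => v; apply: (@nakayama N (addm N (a ^+ n))); last exact: addmr.
  move=> _ /hn/addmP[u [w [uN ->]]]; apply/addSP; exists u, (a ^+ n.+1 *: w).
  split=> //; apply: mem_span; exists a, (a ^+ n *: w); split=> //; first exact: addmr.
  by rewrite scalerA exprS.
exists b => n K chK.
pose L i : submodClosed V := span (fun v => quotmod_pi N v \in K i).
have LP i v : v \in L i <-> quotmod_pi N v \in K i.
  apply: (@spanP _ _ (fun v => quotmod_pi N v \in K i)).
  split=> [|c u u' uK u'K]; first by rewrite raddf0 rpred0.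
  by rewrite linearP rpredD ?rpredZ.
apply: (hb n L) => [i v vN|i j ij].
  apply/LP; suff -> : quotmod_pi N v = 0 by rewrite rpred0.
  by rewrite -(raddf0 (quotmod_pi N)); apply/quotmod_piE; rewrite subr0.
have [sub nsub] := chK i j ij; split=> [v /LP/sub ?|sub']; first exact/LP.
by apply: nsub => q; rewrite -[q]quotmod_pi_repr => /LP/sub'/LP.
Qed.

Lemma mprim_pow N x a j : (forall v, a ^+ j *: v \in addm N x) ->
  forall k v, a ^+ (j * k) *: v \in addm N (x ^+ k).
Proof.
move=> h; elim=> [|k IH] v.
  by rewrite muln0 expr0; apply/addmP; exists 0, v; rewrite rpred0 add0r.
rewrite mulnS exprD -scalerA.
have /addmP[n [u [nN ->]]] := IH v; have /addmP[n' [u' [n'N e]]] := h u.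
apply/addmP; exists (a ^+ j *: n + x ^+ k *: n'), u'.
rewrite rpredD ?rpredZ //; split=> //.
rewrite scalerDr -addrA; congr (_ + _).
by rewrite scalerA mulrC -scalerA e scalerDr scalerA exprSr.
Qed.

Lemma mprim_addm_pow N x k : mprim (addm N x) -> mprim (addm N (x ^+ k)).
Proof. by move=> h a /h[j /mprim_pow hj]; exists (j * k)%N. Qed.

(* This plays the role of Krull's principal ideal theorem.  The submodules
   [I n = (N + c^n V : x^oo)] satisfy [I n + x V = I n.+1 + x V] for some [n], hence
   [I n = I n.+1] by Nakayama. *)
Lemma mprim_exchange N c x : x \in m -> nzd N c ->
  mprim (addm N x) -> mprim (addm N c).
Proof.
move=> xm ncz hx.
pose I n : submodClosed V := span (fun v => exists k, x ^+ k *: v \in addm N (c ^+ n)).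
have IP n v : v \in I n <-> exists k, x ^+ k *: v \in addm N (c ^+ n).
  apply: spanP; split=> [|a u w [k hk] [j hj]].
    by exists 0%N; rewrite scaler0 rpred0.
  exists (k + j)%N; rewrite scalerDr rpredD //.
    have -> : x ^+ (k + j) *: (a *: u) = (x ^+ j * a) *: (x ^+ k *: u).
      by rewrite !scalerA exprD; congr (_ *: _); ring.
    exact: rpredZ.
  by rewrite exprD -scalerA rpredZ.
have [b hb] := chain_bound_mprim hx.
have [||n hn] := dcc (G := fun n => addm (I n) x) hb.
- move=> n; apply: addm_mono => v vN; apply/IP; exists 0%N.
  by rewrite expr0 scale1r; apply: addml.
- move=> n; apply: addm_mono => v /IP[k /addmP[u [w [uN e]]]]; apply/IP; exists k.
  by apply/addmP; exists u, (c *: w); rewrite scalerA -exprSr.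
have In : {subset I n <= I n.+1}.
  apply: nakayama => v vI; have /addmP[u [r [uI ev]]] := hn _ (addml x vI).
  apply/addSP; exists u, (x *: r); split=> //; apply: mem_span; exists x, r; split=> //.
  have : x *: r \in I n.
    have -> : x *: r = v - u by rewrite ev addrC addKr.
    apply: submodB => //; move: uI => /IP[k /addmP[u' [w [u'N e]]]]; apply/IP; exists k.
    by apply/addmP; exists u', (c *: w); rewrite scalerA -exprSr.
  by move=> /IP[k hk]; apply/IP; exists k.+1; rewrite exprSr -scalerA.
have [K hK] := colon_stable (addm N c) x.
have cn j u : c ^+ j *: u \in N -> u \in N.
  elim: j u => [|j IH] u; first by rewrite expr0 scale1r.
  by rewrite exprSr -scalerA => /IH/ncz.
have xK v : x ^+ K *: v \in addm N c.
  have /In/IP[k /addmP[u [w [uN e]]]] : c ^+ n *: v \in I n.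
    by apply/IP; exists 0%N; rewrite expr0 scale1r; apply: addmr.
  apply: (hK k); have h : x ^+ k *: v - c *: w \in N.
    apply: (cn n); rewrite scalerBr !scalerA -exprSr mulrC -scalerA e.
    by rewrite addrK.
  by apply/addmP; exists (x ^+ k *: v - c *: w), w; rewrite subrK.
move=> a /hx[j /mprim_pow/(_ K) hj]; exists (j * K)%N => v.
have /addmP[u [w [uN ->]]] := hj v; rewrite rpredD //; exact: addml.
Qed.

(* Replaces the determinant trick: for [N'] maximal above [N] with
   [Ann (V / N') <= Q], the module [V / N'] becomes cyclic after multiplication
   by some [s] outside [Q]. *)
Lemma mprim_prime N x (Q : submodClosed R^o) : mprim (addm N x) -> isprime Q ->
  x \in Q -> {subset annquot N <= Q} -> {subset m <= Q}.
Proof.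
move=> hx hQ xQ NQ a /hx[k hk].
have [|N' [[NN' N'Q] maxN']] := noethV
  (F := fun N' => {subset N <= N'} /\ {subset annquot N' <= Q}); first by exists N;
      split.
have [v vN'] : exists v, v \notin N'.
  apply: contrapT => no; case: hQ => /negP[]; apply/N'Q/annquotP => v.
  by apply: contrapT => /negP; rewrite scale1r => vN'; apply: no; exists v.
have [s [sQ sV]] : exists s : R, s \notin Q /\ forall u, s *: u \in addv N' v.
  apply: contrapT => no; move/negP: vN'; apply.
  apply: (maxN' (addv N' v)) => [|u|]; last exact: addvr; last exact: addvl.
  split=> [u /NN'|s /annquotP hs]; first exact: addvl.
  by apply: contrapT => /negP sQ; apply: no; exists s.
have /addmP[n [u [nN e]]] := hk v; have /addvP[n' [r [n'N e']]] := sV u.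
pose t := s * a ^+ k - x * r.
have tv : t *: v \in N'.
  rewrite scalerBl -!scalerA e scalerDr (scalerA s) (mulrC s) -(scalerA x) e'.
  by rewrite scalerDr addrA addrK rpredD ?rpredZ // NN'.
have tsQ : t * s \in Q.
  apply/N'Q/annquotP => w; rewrite -scalerA; have /addvP[n2 [r2 [n2N ->]]] := sV w.
  rewrite scalerDr rpredD //; first exact: rpredZ.
  by rewrite scalerA mulrC -scalerA rpredZ.
have tQ : t \in Q by case: (hQ.2 _ _ tsQ) => // h; rewrite h in sQ.
have : s * a ^+ k \in Q.
  have -> : s * a ^+ k = t + r * x by rewrite /t [r * x]mulrC subrK.
  exact: (@rpredD _ Q _ _ tQ (idealM r xQ)).
by move=> /hQ.2[h|/isprimeX]; [rewrite h in sQ|apply].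
Qed.

(** The torsion of [V / N] with respect to [b] is torsion with respect to every element of [m]: some
    power of [a] takes [u] into [N] plus [b ^+ K *: V], where [K] is large enough to kill all
    [b]-torsion, and the second summand is itself [b]-torsion. This is how properties pass from one
    parameter to another. *)
Lemma mprim_torsion N a (b : R) u n : mprim (addm N b) -> a \in m ->
  b ^+ n *: u \in N -> exists k, a ^+ k *: u \in N.
Proof.
move=> hb am bu; have [K hK] := colon_stable N b.
have [k hk] := mprim_addm_pow K hb am; exists k.
have /addmP[n' [w [n'N e]]] := hk u; rewrite e rpredD //.
apply: (hK (n + K)%N); rewrite exprD -scalerA.
have -> : b ^+ K *: w = a ^+ k *: u - n' by rewrite e addrC addKr.
rewrite scalerBr submodB //; last exact: rpredZ.
by rewrite scalerA mulrC -scalerA rpredZ.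
Qed.

End LocalRing.

(** * Prime avoidance and systems of parameters *)

Section PrimeAvoidance.
Variables (R : comNzRingType) (m : idealr R).
Hypotheses (noethR : noethmod R^o).
Implicit Types (I J P Q : submodClosed R^o) (a c x : R).

(** Substitute for the finiteness of the set of minimal primes. A maximal counterexample contains a
    product [a * b] with both factors outside. Every prime above it contains [a] or [b], so the
    lists for the two enlarged ideals can be joined. *)
Lemma primes_below I : exists r (P : 'I_r -> submodClosed R^o),
  (forall i, isprime (P i) /\ {subset I <= P i}) /\
  forall Q, isprime Q -> {subset I <= Q} -> exists i, {subset P i <= Q}.
Proof.
apply: contrapT => nI.
have [|{nI}I [nI maxI]] := noethR (F := fun I => ~ exists r (P : 'I_r -> submodClosed
    R^o),
  (forall i, isprime (P i) /\ {subset I <= P i}) /\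
  forall Q, isprime Q -> {subset I <= Q} -> exists i, {subset P i <= Q}).
  by exists I.
apply: nI; case: (boolP (1 \in I)) => I1.
  have P0 (i : 'I_0) : submodClosed R^o by case: i.
  exists 0%N, P0; split=> [[]//|Q [/negP Q1 _] IQ]; by case: Q1; apply: IQ.
have [pI|nI] := pselect (isprime I).
  by exists 1%N, (fun=> I); split=> [_|Q _ IQ]; [split|exists ord0].
have [a [b [abI aI bI]]] : exists a b : R, [/\ a * b \in I, a \notin I & b \notin I].
  apply: contrapT => no; apply: nI; split=> // a b abI.
  case: (boolP (a \in I)) => aI; first by left.
  case: (boolP (b \in I)) => bI; first by right.
  by exfalso; apply: no; exists a, b.
have enl (c : R) : c \notin I -> exists r (P : 'I_r -> submodClosed R^o),
    (forall i, isprime (P i) /\ {subset addv I (c : R^o) <= P i}) /\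
    forall Q, isprime Q -> {subset addv I (c : R^o) <= Q} -> exists i, {subset P i <=
        Q}.
  move=> cI; apply: contrapT => no; move/negP: cI; apply.
  by apply: (maxI (addv I (c : R^o))) => // [u|]; [exact: addvl|exact: addvr].
have sub Q (c : R) : {subset I <= Q} -> c \in Q -> {subset addv I (c : R^o) <= Q}.
  move=> IQ cQ _ /addvP[n [r [/IQ nQ ->]]]; exact: (@rpredD _ Q _ _ nQ (idealM r cQ)).
have [r [P [hP cP]]] := enl a aI; have [s [P' [hP' cP']]] := enl b bI.
exists (r + s)%N, (fun i => match split i with inl j => P j | inr j => P' j end); split.
  move=> i; case: split => j; [have [? sP] := hP j|have [? sP] := hP' j]; split=> // u
      uI;
    exact/sP/addvl.
move=> Q pQ IQ; case: (pQ.2 a b (IQ _ abI)) => h.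
  by have [i hi] := cP Q pQ (sub Q a IQ h); exists (unsplit (inl i)); rewrite unsplitK.
by have [i hi] := cP' Q pQ (sub Q b IQ h); exists (unsplit (inr i)); rewrite unsplitK.
Qed.

Lemma prime_prod P (T : finType) (A : {set T}) (y : T -> R) : isprime P ->
  (forall j, j \in A -> y j \notin P) -> \prod_(j in A) y j \notin P.
Proof.
move=> [P1 PM] h; apply: (big_ind (fun a => a \notin P)) => // a b aP bP.
by apply/negP => /PM[ha|hb]; [rewrite ha in aP|rewrite hb in bP].
Qed.

Lemma prime_avoidance (T : finType) (P : T -> submodClosed R^o) (A : {set T}) :
  (forall i, i \in A -> isprime (P i) /\ ~ {subset m <= P i}) ->
  exists2 x, x \in m & forall i, i \in A -> x \notin P i.
Proof.
elim: {A}_.+1 {-2}A (ltnSn #|A|) => // n IH A; rewrite ltnS => cA hA.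
have [->|[i iA]] := set_0Vmem A.
  by exists 0 => [|i]; rewrite ?rpred0 ?inE.
have sub j k : j \in A :\ k -> j \in A by rewrite inE => /andP[].
have card k : k \in A -> (#|A :\ k| < n)%N.
  by move=> kA; apply: leq_trans cA; rewrite [X in (_ < X)%N](cardsD1 k) kA.
have [x xm xA] := IH _ (card i iA) (fun j jA => hA j (sub _ _ jA)).
case: (boolP (x \in P i)) => xi; last first.
  exists x => // j jA; case: (eqVneq j i) => [->//|ji].
  by apply: xA; rewrite !inE ji.
(* If [P j] is contained in [P i], it may be dropped: avoiding [P i] suffices. *)
have [[j [jA ji sPj]]|no] := pselect (exists j, [/\ j \in A, j != i & {subset P j <= P
    i}]).
  have [y ym yA] := IH _ (card j jA) (fun k kA => hA k (sub _ _ kA)).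
  exists y => // k kA; case: (eqVneq k j) => [->|kj]; last by apply: yA; rewrite !inE
      kj.
  have : y \notin P i by apply: yA; rewrite !inE eq_sym ji.
  by apply: contra => /sPj.
have wit (P1 : {pred R}) (P2 : submodClosed R^o) : ~ {subset P1 <= P2} ->
    exists y : R, y \in P1 /\ y \notin P2.
  move=> ns; apply: contrapT => ny; apply: ns => y yP; apply: contrapT => /negP yP2.
  by apply: ny; exists y.
have [y0 [y0m y0i]] := wit _ _ (hA i iA).2.
have /choice[y hy] j : exists y : R, j \in A :\ i -> y \in P j /\ y \notin P i.
  case: (boolP (j \in A :\ i)) => [|_]; last by exists 0.
  rewrite !inE => /andP[ji jA]; have [|y hy] := wit (P j) (P i).
    by move=> sPj; apply: no; exists j.
  by exists y.
have zi : y0 * \prod_(j in A :\ i) y j \notin P i.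
  have pPi := (hA i iA).1; have ni : \prod_(j in A :\ i) y j \notin P i.
    by apply: prime_prod => // j /hy[].
  by apply/negP => /pPi.2[h|h]; [rewrite h in y0i|rewrite h in ni].
(* The added product lies in every other [P j] but not in [P i], whereas [x] lies in [P i] and in no
   other [P j]. *)
exists (x + y0 * \prod_(j in A :\ i) y j).
  by rewrite rpredD // mulrC idealMr.
move=> j jA; case: (eqVneq j i) => [->|ji].
  by rewrite (@submod_addl _ _ (P i) (x : R^o)).
have jAi : j \in A :\ i by rewrite !inE ji.
apply: contra (xA j jAi) => h; rewrite -(addrK (y0 * \prod_(j in A :\ i) y j) x).
apply: (@submodB _ _ (P j) (_ : R^o) _ h).
by rewrite (big_setD1 j) //= mulrCA mulrC; apply: idealM; case: (hy j jAi).
Qed.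

(** The element avoids the primes in the two lists of [primes_below] that do not contain [m]; a
    listed prime inside [Q] is one of these. Two ideals are treated together for the sake of
    [common_parameter]. *)
Lemma avoid_primes_below I J : exists2 c, c \in m &
  forall Q, isprime Q -> ~ {subset m <= Q} ->
    ({subset I <= Q} -> exists P, [/\ isprime P, {subset I <= P}, {subset P <= Q} & c
        \notin P]) /\
    ({subset J <= Q} -> exists P, [/\ isprime P, {subset J <= P}, {subset P <= Q} & c
        \notin P]).
Proof.
have [r [P [hP cP]]] := primes_below I; have [s [P' [hP' cP']]] := primes_below J.
pose F i := match i with inl j => P j | inr j => P' j end.
have [|c cm hc] := @prime_avoidance ('I_r + 'I_s)%type F [set i | `[< ~ {subset m <= F
    i} >]].
  by move=> [] i; rewrite inE => /asboolP h; split=> //; [case: (hP i)|case: (hP' i)].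
exists c => // Q pQ nmQ; split=> [IQ|JQ].
  have [i iQ] := cP Q pQ IQ; exists (P i); have [pP IP] := hP i; split=> //.
  by apply: (hc (inl i)); rewrite inE; apply/asboolP => /= mi; apply: nmQ => a /mi/iQ.
have [i iQ] := cP' Q pQ JQ; exists (P' i); have [pP IP] := hP' i; split=> //.
by apply: (hc (inr i)); rewrite inE; apply/asboolP => /= mi; apply: nmQ => a /mi/iQ.
Qed.

End PrimeAvoidance.

Section SystemsOfParameters.
Variables (R : comNzRingType) (m : idealr R).
Hypotheses (noethR : noethmod R^o) (localR : local_ring m).
Implicit Types (I J P Q : submodClosed R^o) (a c x : R).

Section CommonParameter.
Variable V : lmodType R.
Hypothesis noethV : noethmod V.

Lemma mprim_of_primes (N : submodClosed V) :
  (forall Q, isprime Q -> {subset annquot N <= Q} -> {subset m <= Q}) -> mprim m N.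
Proof.
move=> h a am; apply: contrapT => no.
have [|Q [pQ NQ /negP aQ]] := exists_prime_pow (I := annquot N) (a := a) noethR.
  by move=> k; apply/negP => /annquotP ak; apply: no; exists k.
by apply: aQ; apply: (h Q).
Qed.

(** Reduction to the domain [R / P]: there [x] generates an ideal primary to [m], by [mprim_prime],
    and [c], being nonzero, may replace it by [mprim_exchange]. A prime [Q] that contains [P] and
    [c] therefore contains [m]. *)
Lemma mprim_addm_avoid (N : submodClosed V) x c : x \in m ->
  mprim m (addm N x) ->
  (forall Q, isprime Q -> ~ {subset m <= Q} -> {subset annquot N <= Q} ->
     exists P, [/\ isprime P, {subset annquot N <= P}, {subset P <= Q} & c \notin P]) ->
  mprim m (addm N c).
Proof.
move=> xm hx hc; apply: mprim_of_primes => Q pQ cQ; apply: contrapT => nmQ.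
have NQ : {subset annquot N <= Q}.
  by move=> b /annquotP hb; apply/cQ/annquotP => v; apply/addml/hb.
have [P [pP NP PQ cP]] := hc Q pQ nmQ NQ.
have hP : mprim m (addm P x).
  move=> a am; apply: contrapT => no.
  have [|Q' [pQ' PQ' /negP aQ']] := exists_prime_pow (I := addm P x) (a := a) noethR.
    move=> k; apply/negP => ak; apply: no; exists k => v.
    rewrite -[_ *: _]/(_ * _) mulrC; exact: (@idealM _ _ v).
  apply: aQ'; apply: (mprim_prime noethV hx pQ') => //.
    by apply: PQ'; have := @addmr R R^o P x (1 : R); rewrite -[_ *: _]/(_ * _) mulr1.
  by move=> b /NP bP; apply: PQ'; apply: addml.
have nP : nzd P c.
  by move=> v /pP.2[h|//]; rewrite h in cP.
have hPc := mprim_exchange noethR localR noethR xm nP hP.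
apply: nmQ => a /hPc[k /(_ (1 : R))/addmP[n [u [nP' e]]]].
apply: (isprimeX (n := k) pQ); rewrite -[a ^+ k]mulr1 [a ^+ k * 1]e.
apply: (@rpredD _ Q); first exact: PQ.
rewrite -[_ *: _]/(_ * _) mulrC; apply: (@idealM _ _ u); apply: cQ; apply/annquotP => v.
exact: addmr.
Qed.

Lemma common_parameter (N1 N2 : submodClosed V) x1 x2 : x1 \in m -> x2 \in m ->
  mprim m (addm N1 x1) -> mprim m (addm N2 x2) ->
  exists c, [/\ c \in m, mprim m (addm N1 c) & mprim m (addm N2 c)].
Proof.
move=> x1m x2m h1 h2.
have [c cm hc] := avoid_primes_below m noethR (annquot N1) (annquot N2); exists c;
    split=> //.
  by apply: (mprim_addm_avoid x1m h1) => Q pQ nQ NQ; apply: (hc Q pQ nQ).1.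
by apply: (mprim_addm_avoid x2m h2) => Q pQ nQ NQ; apply: (hc Q pQ nQ).2.
Qed.

(** If [s * x ^+ k] kills [V / N], so does [s], and then [s] is in [P]. Hence the products with [s]
    outside [P] miss the annihilator of [V / N], and a prime missing all of them lies in [P] and
    omits [x], which belongs to [P]. *)
Lemma prime_below_nzd (N : submodClosed V) x P : nzd N x -> isprime P ->
  {subset annquot (addm N x) <= P} ->
  exists Q, [/\ isprime Q, {subset annquot N <= Q}, {subset Q <= P} & ~ {subset P <=
      Q}].
Proof.
move=> nx pP xP.
have nxk k v : x ^+ k *: v \in N -> v \in N.
  elim: k => [|k IH]; first by rewrite expr0 scale1r.
  by rewrite exprS -scalerA => /nx.
have P1 := pP.1.
have [||_ [s [k [sP ->]]]|Q [pQ NQ dQ]] :=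
  @exists_prime _ (fun a => exists s k, s \notin P /\ a = s * x ^+ k) (annquot N)
      noethR.
- by exists 1, 0%N; rewrite mulr1.
- move=> _ _ [s [k [sP ->]]] [s' [k' [s'P ->]]]; exists (s * s'), (k + k')%N.
  split; last by rewrite exprD mulrACA.
  by apply/negP => /pP.2[h|h]; [rewrite h in sP|rewrite h in s'P].
- apply/negP => /annquotP h; move/negP: sP; apply; apply/xP/annquotP => v; apply: addml.
  by apply: (nxk k); rewrite scalerA mulrC; exact: h.
have xQ : x \notin Q by apply: dQ; exists 1, 1%N; rewrite mul1r expr1.
exists Q; split=> // [a aQ|PQ].
  apply: contrapT => /negP aP; move: aQ; apply/negP/dQ; exists a, 0%N.
  by rewrite mulr1.
by move/negP: xQ; apply; apply/PQ/xP/annquotP => v; apply: addmr.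
Qed.

End CommonParameter.

(** The recursion starts from the smallest prime, since chains are always prolonged downwards. *)
Fixpoint prime_chain n P : Prop := isprime P /\
  if n is n'.+1 then exists Q, [/\ {subset P <= Q}, ~ {subset Q <= P} & prime_chain n'
      Q] else True.

Lemma prime_chain_prime n P : prime_chain n P -> isprime P. Proof. by case: n => [|n]
    []. Qed.

Lemma prime_chain_chain n P : prime_chain n P -> exists f : nat -> submodClosed R^o,
  [/\ f 0%N = P, forall i, (i <= n)%N -> isprime (f i) &
      forall i, (i < n)%N -> {subset f i <= f i.+1} /\ ~ {subset f i.+1 <= f i}].
Proof.
elim: n P => [|n IH] P [pP].
  by move=> _; exists (fun=> P); split.
move=> [Q [PQ nQP /IH[f [f0 fp fch]]]].
exists (fun i => if i is i'.+1 then f i' else P); split=> // [] [|i] //.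
- exact: fp.
- by rewrite f0.
exact: fch.
Qed.

Lemma krull_dim_bound (V : lmodType R) d n P : krull_dim V d ->
  (forall a, (forall v : V, a *: v = 0) -> a \in P) -> prime_chain n P -> (n <= d)%N.
Proof.
move=> [_ hd] annP /prime_chain_chain[f [f0 fp fch]]; apply: hd.
have hp (i : 'I_n.+1) : isprime (f i) by apply: fp; rewrite -ltnS.
have mono i j : (i <= j <= n)%N -> {subset f i <= f j}.
  move=> /andP[/subnK <-]; elim: (j - i)%N => [|k IH] kn v; first by rewrite add0n.
  by move=> /(IH (ltnW kn)); apply: (fch (k + i)%N kn).1.
exists (fun i => prime_of (hp i) : prime_idealr R); split=> [i a /annP aP|i j ij].
  by apply: (mono 0%N i); [rewrite leq0n -ltnS ltn_ord|rewrite f0].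
have jn : (j <= n)%N by rewrite -ltnS.
split; first by apply: mono; rewrite (ltnW ij) jn.
move=> sub; apply: (fch i (leq_trans ij jn)).2 => v vi; apply: sub.
by apply: (mono i.+1 j) => //; rewrite ij jn.
Qed.

Lemma isprime_max : isprime (ideal_sub m).
Proof.
split; first by apply/negP => /ideal_subP; rewrite idealr1.
move=> a b /ideal_subP ab.
case: (boolP (a \in m)) => [am|/(local_unit noethR localR)[c ca]].
  by left; apply/ideal_subP.
by right; apply/ideal_subP; rewrite -[b]mul1r -ca -mulrA idealMr.
Qed.

(** Adjoining [c] lowers the bound by one: a chain above [I] and [c] whose first prime does not
    contain [m] can be prolonged downwards by a prime above [I] that omits [c]. *)
Lemma exists_parameters I n :
  (forall P k, {subset I <= P} -> prime_chain k P -> (k <= n)%N) ->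
  exists x : 'I_n -> R, (forall j, x j \in m) /\
    forall Q, isprime Q -> {subset I <= Q} -> (forall j, x j \in Q) -> {subset m <= Q}.
Proof.
elim: n I => [|n IH] I hI.
  exists (fun=> 0); split=> [j|Q pQ IQ _]; first exact: rpred0.
  apply: contrapT => nmQ; suff: (1 <= 0)%N by [].
  apply: (hI Q) => //; split=> //; exists (ideal_sub m); split.
  - by move=> a aQ; apply/ideal_subP; apply: (mprime_sub noethR localR pQ).
  - by move=> mQ; apply: nmQ => a am; apply/mQ/ideal_subP.
  by split=> //; exact: isprime_max.
have [c cm hc] := avoid_primes_below m noethR I I.
have [|x [xm hx]] := IH (addv I (c : R^o)).
  move=> P k IP kP; have pP := prime_chain_prime kP.
  have [mP|nmP] := pselect {subset m <= P}.
    case: k kP => // k [_ [Q [PQ nQP /prime_chain_prime/(mprime_sub noethR localR)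
        Qm]]].
    by exfalso; apply: nQP => a /Qm/mP.
  have [|P0 [pP0 IP0 P0P cP0]] := (hc P pP nmP).1.
    by move=> a aI; apply/IP/addvl.
  rewrite -ltnS; apply: (hI P0) => //; split=> //; exists P; split=> //.
  by move=> PP0; move/negP: cP0; apply; apply/PP0/IP/addvr.
exists (fun j => if unlift ord0 j is Some j' then x j' else c); split.
  by move=> j; case: unliftP => [j' _|_].
move=> Q pQ IQ xQ; apply: hx => // [a|j]; last first.
  by have := xQ (lift ord0 j); rewrite liftK.
have cQ : c \in Q by have := xQ ord0; rewrite unlift_none.
move=> /addvP[b [r [/IQ bQ ->]]]; exact: (@rpredD _ Q _ _ bQ (idealM r cQ)).
Qed.

End SystemsOfParameters.

(** * Regular sequences and limit closure *)

Section WeaklyRegular.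
Variables (R : comNzRingType) (V : lmodType R).
Implicit Types (N : submodClosed V) (a b u : R) (s : seq R).

Fixpoint seqsub N s : submodClosed V :=
  if s is a :: s' then seqsub (addm N a) s' else N.

(** A regular sequence on [V / N], without the condition that the final quotient be nonzero; that
    condition is treated in [gensub_proper]. *)
Fixpoint wregular N s : Prop :=
  if s is a :: s' then nzd N a /\ wregular (addm N a) s' else True.

Lemma addm_ext N N' a : N =i N' -> addm N a =i addm N' a.
Proof.
by move=> e v; apply/idP/idP; apply: addm_mono => u; rewrite e.
Qed.

Lemma addmC N a b : addm (addm N a) b =i addm (addm N b) a.
Proof.
suff sub c e : {subset addm (addm N c) e <= addm (addm N e) c}.
  by move=> v; apply/idP/idP; apply: sub.
move=> _ /addmP[_ [w [/addmP[n [w' [nN ->]]] ->]]]; rewrite addrAC.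
by apply: rpredD; [apply: addml; apply/addmP; exists n, w | apply: addmr].
Qed.

Lemma seqsub_ext N N' s : N =i N' -> seqsub N s =i seqsub N' s.
Proof. by elim: s N N' => //= a s IH N N' e; apply/IH/addm_ext. Qed.

Lemma seqsub_addm N s a : seqsub (addm N a) s =i addm (seqsub N s) a.
Proof.
elim: s N => //= b s IH N v.
by rewrite (seqsub_ext s (addmC N a b)) IH.
Qed.

Lemma nzd_ext N N' a : N =i N' -> nzd N a -> nzd N' a.
Proof. by move=> e h v; rewrite -!e; apply: h. Qed.

Lemma wregular_ext N N' s : N =i N' -> wregular N s -> wregular N' s.
Proof.
elim: s N N' => //= a s IH N N' e [na ws]; split; first exact: nzd_ext na.
by apply: IH ws; apply: addm_ext.
Qed.

Lemma nzd_swap N a b : nzd N a -> nzd (addm N a) b -> nzd (addm N b) a.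
Proof.
move=> na nb v /addmP[n [w [nN e]]].
have /nb/addmP[n' [w' [n'N ew]]] : b *: w \in addm N a.
  by apply/addmP; exists (- n), v; rewrite submodN // e addKr.
have h : v - b *: w' \in N.
  apply: na; rewrite scalerBr e ew scalerDr !scalerA [a * b]mulrC addrA addrK.
  by rewrite rpredD // rpredZ.
by apply/addmP; exists (v - b *: w'), w'; rewrite subrK.
Qed.

(** Iterating [nzd_swap] moves the first element past all the others. *)
Lemma nzd_seqsub N a s : nzd N a -> wregular (addm N a) s -> nzd (seqsub N s) a.
Proof.
elim: s N => //= b s IH N na [nb ws]; apply: IH; first exact: nzd_swap.
exact: wregular_ext (addmC N a b) ws.
Qed.

Lemma nzdM N a b : nzd N a -> nzd N b -> nzd N (a * b).
Proof. by move=> na nb v; rewrite -scalerA => /na/nb. Qed.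

Lemma nzdX N a k : nzd N a -> nzd N (a ^+ k).
Proof.
by move=> na; elim: k => [|k IH]; [move=> v; rewrite expr0 scale1r | rewrite exprS;
    apply: nzdM].
Qed.

(** Modulo [N], the quotient by [a * b] is an extension of the quotient by [b] by a copy of the
    quotient by [a]. *)
Lemma wregular_mul N a b s : nzd N a -> nzd N b ->
  wregular (addm N a) s -> wregular (addm N b) s -> wregular (addm N (a * b)) s.
Proof.
elim: s N => //= c s IH N na nb [nca wa] [ncb wb]; split; last first.
  apply: (wregular_ext (addmC N c (a * b))); apply: IH; try exact: nzd_swap.
    exact: wregular_ext (addmC N a c) wa.
  exact: wregular_ext (addmC N b c) wb.
move=> v /addmP[n [w [nN e]]].
have /ncb/addmP[n1 [v1 [n1N ev]]] : c *: v \in addm N b.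
  by apply/addmP; exists n, (a *: w); rewrite e scalerA mulrC.
have h : c *: v1 - a *: w \in N.
  apply: nb; have -> : b *: (c *: v1 - a *: w) = n - c *: n1.
    apply/eqP; rewrite eq_sym subr_eq scalerBr addrAC -subr_eq opprK.
    by rewrite !scalerA [b * a]mulrC -e ev scalerDr scalerA [c * b]mulrC addrC.
  by rewrite submodB // rpredZ.
have /nca/addmP[n2 [w2 [n2N ev1]]] : c *: v1 \in addm N a.
  by apply/addmP; exists (c *: v1 - a *: w), w; rewrite subrK.
apply/addmP; exists (n1 + b *: n2), w2; rewrite rpredD ?rpredZ //; split=> //.
by rewrite ev ev1 scalerDr scalerA [b * a]mulrC addrA.
Qed.

Lemma wregularX N a k s : wregular N (a :: s) -> wregular N (a ^+ k.+1 :: s).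
Proof.
move=> [na ws]; elim: k => [|k [nk wk]]; first by rewrite expr1.
by split; rewrite exprS; [apply: nzdM | apply: wregular_mul].
Qed.

Lemma wregular_pow I (x : I -> R) (e : I -> nat) (s : seq I) N :
  wregular N [seq x i | i <- s] -> wregular N [seq x i ^+ (e i).+1 | i <- s].
Proof.
elim: s N => //= i s IH N [ni ws].
by apply: (@wregularX N (x i) (e i)); split=> //; apply: IH.
Qed.

(** The factors are cancelled one at a time, since [x i] is a nonzerodivisor modulo the powers of
    the later parameters. The case [n = 0] is limit closure. *)
Lemma wregular_cancel I (x : I -> R) (s : seq I) n t N v :
  wregular N [seq x i | i <- s] ->
  (\prod_(i <- s) x i ^+ t) *: v \in seqsub N [seq x i ^+ (n + t).+1 | i <- s] ->
  v \in seqsub N [seq x i ^+ n.+1 | i <- s].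
Proof.
elim: s N v => [|i s IH] N v /=; first by rewrite big_nil scale1r.
move=> hw; rewrite seqsub_addm => /addmP[l [w [lN e]]].
have [ni ws] := hw; have [_ wsn] := wregularX n hw.
have nxi : nzd (seqsub N [seq x j ^+ (n + t).+1 | j <- s]) (x i).
  by apply: nzd_seqsub => //; apply: (wregular_pow (fun=> n + t)%N).
apply: IH => //; rewrite seqsub_addm.
set P := \prod_(j <- s) _ in e *.
have h : P *: v - x i ^+ n.+1 *: w \in seqsub N [seq x j ^+ (n + t).+1 | j <- s].
  apply: (@nzdX _ _ t nxi).
  rewrite scalerBr !scalerA -exprD addnC addSn; move: e; rewrite big_cons => ->.
  by rewrite addrK.
by apply/addmP; exists (P *: v - x i ^+ n.+1 *: w), w; rewrite subrK.
Qed.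

(** With [S] the maximal ideal: multiplication by the product of all [x i ^+ n] maps the socle
    modulo the [x i] onto the socle modulo the [x i ^+ n.+1]. In each step, [v] being killed by
    [x i] forces [v] to be a multiple of [x i ^+ n] modulo the other powers. *)
Lemma wregular_socle I (x : I -> R) (s : seq I) n (S : R -> Prop) N v :
  (forall i, S (x i)) -> wregular N [seq x i | i <- s] ->
  (forall a, S a -> a *: v \in seqsub N [seq x i ^+ n.+1 | i <- s]) ->
  exists w, v - (\prod_(i <- s) x i ^+ n) *: w \in seqsub N [seq x i ^+ n.+1 | i <- s]
      /\
    forall a, S a -> a *: w \in seqsub N [seq x i | i <- s].
Proof.
move=> Sx; elim: s N v => [|i s IH] N v /=.
  by move=> _ h; exists v; rewrite big_nil scale1r subrr rpred0.
move=> hw hv; have [ni ws] := hw; set L := seqsub N [seq x j ^+ n.+1 | j <- s].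
have nxi : nzd L (x i).
  by apply: nzd_seqsub => //; apply: (wregular_pow (fun=> n)).
have LE a : seqsub (addm N a) [seq x j ^+ n.+1 | j <- s] =i addm L a by exact:
    seqsub_addm.
have := hv _ (Sx i); rewrite LE => /addmP[l [v' [lL e]]].
have h : v - x i ^+ n *: v' \in L.
  by apply: nxi; rewrite scalerBr e scalerA -exprS addrK.
have [|w [hw1 hw2]] := IH (addm N (x i)) v' ws.
  move=> a Sa; rewrite LE; have := hv a Sa; rewrite LE => /addmP[l1 [w1 [l1L e1]]].
  have h' : a *: v' - x i *: w1 \in L.
    apply: (@nzdX _ _ n nxi).
    have -> : x i ^+ n *: (a *: v' - x i *: w1) = l1 - a *: (v - x i ^+ n *: v').
      have -> : l1 = a *: v - x i ^+ n.+1 *: w1 by rewrite e1 addrK.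
      rewrite !scalerBr opprB [RHS]addrC addrA subrK.
      by rewrite !scalerA -exprSr [a * _]mulrC.
    by rewrite submodB // rpredZ.
  by apply/addmP; exists (a *: v' - x i *: w1), w1; rewrite subrK.
exists w; split=> //; rewrite big_cons LE.
have {hw1} := hw1; rewrite LE => /addmP[l2 [w2 [l2L e2]]].
have -> : v - (x i ^+ n * \prod_(j <- s) x j ^+ n) *: w =
    (v - x i ^+ n *: v') + x i ^+ n *: l2 + x i ^+ n.+1 *: w2.
  rewrite -addrA exprSr -[in RHS]scalerA -scalerDr -e2 scalerBr scalerA addrA subrK.
  by [].
exact: rpredD (rpredD (addml _ h) (rpredZ _ (addml _ l2L))) (addmr _ _ _).
Qed.

Lemma wregular_rcons N s a : wregular N s -> nzd (seqsub N s) a -> wregular N (rcons s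
    a).
Proof. by elim: s N => [|b s IH] N /= => [_ h|[nb ws] h]; split=> //; apply: IH. Qed.

Lemma wregular_take N s a : (forall k, (k < size s)%N -> nzd (seqsub N (take k s)) (nth
    a s k)) ->
  wregular N s.
Proof.
elim: s N => //= b s IH N h; split; first exact: (h 0%N).
by apply: IH => k ks; apply: (h k.+1).
Qed.

(** [prime_below_nzd] adds one prime at the bottom of the chain for each element of [s]; this bounds
    the length of regular sequences by the dimension. *)
Lemma depth_chain (noethR : noethmod R^o) (n : nat) N s (P : submodClosed R^o) :
  wregular N s -> prime_chain n P -> {subset annquot (seqsub N s) <= P} ->
  exists Q : submodClosed R^o, {subset annquot N <= Q} /\ prime_chain (size s + n) Q.
Proof.
elim: s N P n => [|a s IH] N P n /=; first by move=> _ nP NP; exists P.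
move=> [na ws] nP NP; have [Q [NQ nQ]] := IH _ _ _ ws nP NP.
have [Q' [pQ' NQ' Q'Q nQQ']] := prime_below_nzd noethR na (prime_chain_prime nQ) NQ.
by exists Q'; split=> //; split=> //; exists Q.
Qed.

End WeaklyRegular.

(** * Monomial relations between parameters *)

Section Monomials.
Variables (R : comNzRingType) (V : lmodType R) (d : nat).
Implicit Types (x : 'I_d -> R) (J : pred 'I_d) (e f : 'I_d -> nat) (N : submodClosed V).

Definition zeroS : submodClosed V := lspan [::].

Lemma zeroSP v : v \in zeroS <-> v = 0.
Proof.
split=> [|->]; last exact: rpred0.
apply: (span_ind (P := fun v => v = 0)) => //.
by split=> // a _ _ -> ->; rewrite scaler0 addr0.
Qed.

Definition gensub x J : submodClosed V :=
  span (fun v => exists i u, J i /\ v = x i *: u).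

Lemma mem_gensub x J i u : J i -> x i *: u \in gensub x J.
Proof. by move=> Ji; apply: mem_span; exists i, u. Qed.

Lemma gensub_mono x J J' : {subset J <= J'} -> {subset gensub x J <= gensub x J'}.
Proof.
by move=> h; apply: span_sub => _ [i [u [/h Ji ->]]]; apply: mem_gensub.
Qed.

Lemma gensub_ext x J J' : J =1 J' -> gensub x J =i gensub x J'.
Proof.
by move=> h v; apply/idP/idP; apply: gensub_mono => i; rewrite -!topredE /= h.
Qed.

Lemma imul_gen x : imul (ideal_gen x) (@predT V) =i gensub x xpredT.
Proof.
move=> v; apply/idP/idP; apply: span_sub => w; last first.
  move=> [i [u [_ ->]]]; apply: mem_span; exists (x i), u; split=> //.
  by apply: mem_span; exists i.
move=> [a [u [aq _ ->]]].
move: aq; apply: (@span_ind R R^o _ (fun a : R => a *: u \in gensub x xpredT)).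
  split=> [|c b b' h h']; first by rewrite scale0r rpred0.
  by rewrite scalerDl -scalerA rpredD // rpredZ.
by move=> _ [i ->]; apply: mem_gensub.
Qed.

Lemma seqsub_gensub N x (s : seq 'I_d) :
  seqsub N [seq x i | i <- s] =i addS N (gensub x (mem s)).
Proof.
elim: s N => [|i s IH] N v /=; last rewrite IH.
  apply/idP/idP => [|/addSP[n [u [nN uD ->]]]]; first exact: addSl.
  by rewrite rpredD //; apply: (span_sub _ uD) => w [j [u' []]].
apply/idP/idP => /addSP[w [u [wN uD ->]]].
  move/addmP: wN => [n [w' [nN ->]]]; rewrite -addrA; apply/addSP.
  exists n, (x i *: w' + u); split=> //; rewrite rpredD //.
    by apply: mem_gensub; rewrite /= mem_head.
  by apply: gensub_mono uD => j; rewrite -!topredE /= inE => ->; rewrite orbT.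
rewrite rpredD //; first by apply/addSl/addml.
apply: span_sub uD => _ [j [w' [/predU1P[->|js] ->]]]; first exact/addSl/addmr.
exact/addSr/mem_gensub.
Qed.

Lemma seqsub_zero x (s : seq 'I_d) : seqsub zeroS [seq x i | i <- s] =i gensub x (mem
    s).
Proof.
move=> v; rewrite seqsub_gensub; apply/idP/idP; last exact: addSr.
by move=> /addSP[n [u [/zeroSP -> uD ->]]]; rewrite add0r.
Qed.

Lemma gensub_addm x i : addm (gensub x (predC1 i)) (x i) =i gensub x xpredT.
Proof.
move=> v; apply/idP/idP => [/addmP[n [u [nD ->]]]|].
  by rewrite rpredD //; [apply: gensub_mono nD | apply: mem_gensub].
apply: span_sub => _ [j [u [_ ->]]]; case: (eqVneq j i) => [->|ji]; first exact: addmr.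
by apply/addml/mem_gensub.
Qed.

Definition mon x e : R := \prod_j x j ^+ e j.

Lemma monD x e f : mon x (fun j => e j + f j)%N = mon x e * mon x f.
Proof. by rewrite /mon -big_split /=; apply: eq_bigr => j _; rewrite exprD. Qed.

Lemma mon0 x : mon x (fun=> 0%N) = 1.
Proof. by rewrite /mon big1. Qed.

Lemma eq_mon x e f : e =1 f -> mon x e = mon x f.
Proof. by move=> ef; apply: eq_bigr => j _; rewrite ef. Qed.

Definition delta (i : 'I_d) : 'I_d -> nat := fun j => (j == i).

Lemma mon_delta x i : mon x (delta i) = x i.
Proof.
rewrite /mon (bigD1 i) //= /delta eqxx expr1 big1 ?mulr1 // => j /negPf ->.
exact: expr0.
Qed.

Lemma sum_delta i : (\sum_j delta i j = 1)%N.
Proof. by rewrite (bigD1 i) //= /delta eqxx big1 // => j /negPf ->. Qed.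

Lemma mon_xpow x e k i u : (k <= e i)%N ->
  mon x e *: u \in gensub (xpow x k) xpredT.
Proof.
move=> ke; rewrite /mon (bigD1 i) //= -(subnKC ke) exprD -mulrA -scalerA.
exact: (@mem_gensub (xpow x k)).
Qed.

Definition monspan x (S : ('I_d -> nat) -> Prop) : submodClosed V :=
  span (fun v => exists e u, S e /\ v = mon x e *: u).

Lemma mem_monspan x (S : ('I_d -> nat) -> Prop) e u : S e -> mon x e *: u \in monspan x
    S.
Proof. by move=> Se; apply: mem_span; exists e, u. Qed.

Lemma monspan_mono x (S S' : ('I_d -> nat) -> Prop) : (forall e, S e -> S' e) ->
  {subset monspan x S <= monspan x S'}.
Proof.
by move=> h; apply: span_sub => _ [e [u [/h Se ->]]]; apply: mem_monspan.
Qed.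

(* That is, [V / (x) V] embeds in the direct limit of the [V / (x ^ t) V]. *)
Definition limit_closed x : Prop := forall t (v : V),
  (\prod_j x j ^+ t) *: v \in gensub (xpow x t.+1) xpredT -> v \in gensub x xpredT.

(** Padding [e] to the constant exponent [t], its largest entry, turns every monomial with some
    [e i < f i] into a multiple of [x i ^+ t.+1]. *)
Lemma limit_closed_mon x e v : limit_closed x ->
  mon x e *: v \in monspan x (fun f => exists i, (e i < f i)%N) -> v \in gensub x
      xpredT.
Proof.
move=> hx he; pose t := (\max_j e j)%N.
have et j : (e j <= t)%N by apply: leq_bigmax.
apply: (hx t); have -> : \prod_j x j ^+ t = mon x (fun j => t - e j)%N * mon x e.
  by rewrite -monD; apply: eq_bigr => j _; rewrite subnK.
rewrite -scalerA; move: he; apply: (span_ind (P := fun w =>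
  mon x (fun j => t - e j)%N *: w \in gensub (xpow x t.+1) xpredT)).
  split=> [|c u w hu hw]; first by rewrite scaler0 rpred0.
  by rewrite scalerDr scalerA mulrC -scalerA rpredD // rpredZ.
move=> _ [f [u [[i ef] ->]]]; rewrite scalerA -monD; apply: (@mon_xpow x _ _ i).
by have := et i; lia.
Qed.

Definition powsub x n : submodClosed V := monspan x (fun e => \sum_j e j = n)%N.

(** In degree [n] all exponents are at most [n], so sums over monomials have a finite index type. *)
Local Notation exps n := {ffun 'I_d -> 'I_n.+1}.

Lemma powsubP x n v : v \in powsub x n -> exists w : exps n -> V,
  v = \sum_(t : exps n | (\sum_j t j == n)%N) mon x (fun j => t j : nat) *: w t.
Proof.
apply: (span_ind (P := fun v => exists w : exps n -> V, v =
  \sum_(t : exps n | (\sum_j t j == n)%N) mon x (fun j => t j : nat) *: w t)).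
  split=> [|c _ _ [w ->] [w' ->]].
    by exists (fun=> 0); rewrite big1 // => t _; rewrite scaler0.
  exists (fun t => c *: w t + w' t); rewrite scaler_sumr -big_split /=.
  by apply: eq_bigr => t _; rewrite scalerDr !scalerA [c * _]mulrC.
move=> _ [e [u [en ->]]].
have ej j : (e j < n.+1)%N by rewrite ltnS -en (bigD1 j) //= leq_addr.
pose t0 : exps n := [ffun j => Ordinal (ej j)].
have t0e j : t0 j = e j :> nat by rewrite ffunE.
exists (fun t => if t == t0 then u else 0).
rewrite (bigD1 t0) /=; last by under eq_bigr do rewrite t0e; rewrite en.
rewrite eqxx big1 ?addr0; first by congr (_ *: _); apply: eq_mon.
by move=> t /andP[_ /negPf ->]; rewrite scaler0.
Qed.

Lemma exceed e f : e <> f -> (\sum_j f j <= \sum_j e j)%N -> exists k, (f k < e k)%N.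
Proof.
move=> ne le; apply: contrapT => no.
have h k : (e k <= f k)%N by rewrite leqNgt; apply/negP => hk; apply: no; exists k.
apply: ne; apply/funext => k; apply/eqP; rewrite eqn_leq h /=.
move: le; rewrite (bigD1 k) //= [X in (_ <= X)%N](bigD1 k) //=.
have : (\sum_(i | i != k) e i <= \sum_(i | i != k) f i)%N by apply: leq_sum.
by set A := (\sum_(i | _) e i)%N; set B := (\sum_(i | _) f i)%N; lia.
Qed.

(* Comparing degrees, no other monomial of the relation divides the monomial with
   exponent [s + t0], so [limit_closed_mon] applies to the coefficient [w t0]. *)
Lemma limit_closed_coef x n s (S : ('I_d -> nat) -> Prop) (w : exps n -> V) (t0 : exps
    n) :
  limit_closed x -> (\sum_j t0 j = n)%N ->
  (forall e, S e -> exists k, (s k + t0 k < e k)%N) ->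
  mon x s *: (\sum_(t : exps n | (\sum_j t j == n)%N) mon x (fun j => t j : nat) *: w t)
    \in monspan x S ->
  w t0 \in gensub x xpredT.
Proof.
move=> hx t0n hS; rewrite (bigD1 t0) /=; last by rewrite t0n.
set rest := \sum_(t | _) _ => h.
apply: (@limit_closed_mon x (fun j => s j + t0 j)%N _ hx).
rewrite monD -scalerA.
have -> : mon x s *: (mon x (fun j => t0 j : nat) *: w t0) =
    mon x s *: (mon x (fun j => t0 j : nat) *: w t0 + rest) - mon x s *: rest.
  by rewrite scalerDr addrK.
apply: submodB; first by apply: monspan_mono h.
rewrite scaler_sumr; apply: rpred_sum => t /andP[/eqP tn tt0].
rewrite scalerA -monD; apply: mem_monspan.
have [||k hk] := @exceed (fun j => t j : nat) (fun j => t0 j : nat).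
- move=> e; move/eqP: tt0; apply; apply/ffunP => j; apply: val_inj.
  exact: (congr1 (fun g => g j) e).
- by rewrite tn t0n.
by exists k; rewrite ltn_add2l.
Qed.

Lemma powsub_mul x n i v : v \in powsub x n -> x i *: v \in powsub x n.+1.
Proof.
apply: (span_ind (P := fun v => x i *: v \in powsub x n.+1)).
  split=> [|c u w hu hw]; first by rewrite scaler0 rpred0.
  by rewrite scalerDr scalerA mulrC -scalerA rpredD // rpredZ.
move=> _ [e [u [en ->]]]; rewrite scalerA -(mon_delta x) -monD; apply: mem_monspan.
by rewrite big_split /= sum_delta en.
Qed.

Lemma mon_gensub x e u n : (\sum_j e j = n)%N -> u \in gensub x xpredT ->
  mon x e *: u \in powsub x n.+1.
Proof.
move=> en; apply: (span_ind (P := fun u => mon x e *: u \in powsub x n.+1)).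
  split=> [|c v w hu hw]; first by rewrite scaler0 rpred0.
  by rewrite scalerDr scalerA mulrC -scalerA rpredD // rpredZ.
move=> _ [i [v [_ ->]]]; rewrite scalerA mulrC -scalerA; apply: powsub_mul.
exact: mem_monspan.
Qed.

Lemma powsub_imul x n : imul (ipow (ideal_gen x) n) (@predT V) =i powsub x n.
Proof.
move=> v; apply/idP/idP; apply: span_sub => w.
  move=> [a [u [aq _ ->]]]; elim: n a aq u => [|n IH] a aq u /=.
    by rewrite rpredZ // -[u]scale1r -(mon0 x); apply: mem_monspan; rewrite big1.
  move: aq; apply: (@span_ind R R^o _ (fun a : R => a *: u \in powsub x n.+1)).
    split=> [|c b b' h h']; first by rewrite scale0r rpred0.
    by rewrite scalerDl -scalerA rpredD // rpredZ.
  move=> _ [b [c [bq /IH cq ->]]]; rewrite -[b *: c]/(b * c) -scalerA.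
  move: (cq u); move: (c *: u) bq => {c cq} z bq zq; move: bq.
  apply: (@span_ind R R^o _ (fun b : R => b *: z \in powsub x n.+1)).
    split=> [|c e e' h h']; first by rewrite scale0r rpred0.
    by rewrite scalerDl -scalerA rpredD // rpredZ.
  by move=> _ [i ->]; apply: powsub_mul.
move=> [e [u [en ->]]]; apply: mem_span; exists (mon x e), u; split=> // {w v u}.
elim: n e en => // n IH e en.
have [i ei] : exists i, (0 < e i)%N.
  apply: contrapT => no; move: en; rewrite big1 // => i _.
  by apply/eqP; rewrite eqn0Ngt; apply/negP => h; apply: no; exists i.
have ee : e =1 (fun j => delta i j + (e j - delta i j))%N.
  by move=> j; rewrite subnKC // /delta; case: eqP => // ->.
rewrite (eq_mon x ee) monD mon_delta; apply: mem_span.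
exists (x i), (mon x (fun j => e j - delta i j)%N); split=> //.
  by apply: mem_span; exists i.
apply: IH; move: en; rewrite (eq_bigr _ (fun j _ => ee j)) big_split /= sum_delta.
by move=> [].
Qed.

Lemma pigeonhole K e : \sum_j e j = (d * K).+1 -> exists j, (K < e j)%N.
Proof.
move=> h; apply: contrapT => no; suff: ((d * K).+1 <= d * K)%N by rewrite ltnn.
rewrite -{1}h -[X in (_ <= X * _)%N](card_ord d) -sum_nat_const; apply: leq_sum => j _.
by rewrite leqNgt; apply/negP => hj; apply: no; exists j.
Qed.

Section Noetherian.
Variable m : idealr R.
Hypotheses (noethR : noethmod R^o) (localR : local_ring m) (noethV : noethmod V).

Lemma powsub_mprim x N : (forall j, x j \in m) -> mprim m N ->
  exists n, {subset powsub x n <= N}.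
Proof.
move=> xm hN; have /choice[k hk] j := hN _ (xm j).
exists (d * (\max_j k j)).+1; apply: span_sub => _ [e [u [/pigeonhole[j hj] ->]]].
rewrite /mon (bigD1 j) //= mulrC -scalerA; apply: rpredZ.
have kj : (k j <= e j)%N by apply: leq_trans (ltnW hj); apply: leq_bigmax.
by rewrite -(subnKC kj) exprD -scalerA.
Qed.

(** By induction on [n], an element that [x i] takes into [gensub x J] lies in [gensub x J] plus
    [powsub x n]. Terms of degree [n] involving some [x j] with [J j] are absorbed. For any other
    term, no such [x j] divides [x i] times its monomial, so [limit_closed_coef] puts its
    coefficient in q M and its degree rises. Krull's intersection theorem concludes. *)
Lemma limit_closed_nzd x J i : (forall j, x j \in m) -> limit_closed x -> ~~ J i ->
  nzd (gensub x J) (x i).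
Proof.
move=> xm hx Ji v xv.
apply: (@krull_intersection _ _ noethR localR V noethV (gensub x J) (colon (gensub x J)
    (x i))).
- by move=> u uJ; apply/colonP/rpredZ.
- move=> C JC hC u /colonP xu; have [n hn] := powsub_mprim xm hC.
  suff /addSP[u0 [u1 [/JC u0C /hn u1C ->]]] : u \in addS (gensub x J) (powsub x n) by
      rewrite rpredD.
  elim: {hn}n => [|n IH].
    by apply/addSr; rewrite -[u]scale1r -(mon0 x); apply: mem_monspan; rewrite big1.
  have {IH}/addSP[u0 [u1 [u0J /powsubP[w eu1] eu]]] := IH.
  rewrite eu rpredD //; first exact: addSl.
  have xu1 : x i *: u1 \in gensub x J.
    have -> : u1 = u - u0 by rewrite eu addrC addKr.
    by rewrite scalerBr submodB // rpredZ.
  rewrite eu1; apply: rpred_sum => t /eqP tn.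
  have [/existsP[j /andP[Jj tj]]|/existsPn noj] := boolP [exists j, J j && (0 < t j)%N].
    apply/addSl; rewrite /mon (bigD1 j) //= -(prednK tj) exprS -mulrA -scalerA.
    exact: mem_gensub.
  apply/addSr/mon_gensub => //.
  apply: (@limit_closed_coef x n (delta i) (fun e => exists2 j, J j & (0 < e j)%N) w t
      hx tn).
    move=> e [j Jj ej]; exists j; have := noj j; rewrite Jj /= -leqNgt leqn0 => /eqP ->.
    by rewrite /delta; case: eqP => [ji|]; [rewrite -ji Jj in Ji|rewrite addn0].
  rewrite -eu1 mon_delta; move: xu1; apply: span_sub => _ [j [u' [Jj ->]]].
  by rewrite -(mon_delta x j); apply: mem_monspan; exists j; rewrite // /delta eqxx.
exact/colonP.
Qed.

(** As long as [k < n], the relation places the coefficients of the degree [k] expansion of [v] in q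
    M, which moves [v] to degree [k.+1]. *)
Lemma limit_closed_socle x n v (i : 'I_d) : limit_closed x ->
  x i *: v \in powsub x n.+1 -> v \in powsub x n.
Proof.
move=> hx xv; suff h k : (k <= n)%N -> v \in powsub x k by apply: h.
elim: k => [_|k IH kn].
  by rewrite -[v]scale1r -(mon0 x); apply: mem_monspan; rewrite big1.
have /powsubP[w ev] := IH (ltnW kn); rewrite ev; apply: rpred_sum => t /eqP tk.
apply: mon_gensub => //.
apply: (@limit_closed_coef x k (delta i) (fun e => \sum_j e j = n.+1)%N w t hx tk).
  move=> e en; apply: (@exceed e (fun j => delta i j + t j)%N).
    move=> ee; move: en; rewrite ee big_split /= sum_delta tk; lia.
  by rewrite en big_split /= sum_delta tk; lia.
by rewrite -ev mon_delta.
Qed.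

Lemma limit_closed_indep x n (w : exps n -> V) (t0 : exps n) : limit_closed x ->
  \sum_(t : exps n | (\sum_j t j == n)%N) mon x (fun j => t j : nat) *: w t \in powsub
      x n.+1 ->
  (\sum_j t0 j = n)%N -> w t0 \in gensub x xpredT.
Proof.
move=> hx h t0n.
apply: (@limit_closed_coef x n (fun=> 0%N) (fun e => \sum_j e j = n.+1)%N w t0 hx t0n).
  move=> e en; have [||k hk] := @exceed e (fun j => t0 j : nat).
  - by move=> ee; move: en; rewrite ee t0n; lia.
  - by rewrite en t0n.
  by exists k.
by rewrite mon0 scale1r.
Qed.

End Noetherian.

End Monomials.

(** * Socles and the index of reducibility *)

Section SocleBases.
Variables (R : comNzRingType) (m : idealr R).

(* A basis of the socle of [V / N], with coordinates in [R / m] lifted to [R]. *)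
Definition socle_basis (V : lmodType R) (N : submodClosed V) (T : finType) (b : T -> V)
    : Prop :=
  [/\ forall t a, a \in m -> a *: b t \in N,
      forall v, (forall a, a \in m -> a *: v \in N) ->
        exists c : T -> R, v - \sum_t c t *: b t \in N
    & forall c : T -> R, \sum_t c t *: b t \in N -> forall t, c t \in m].

Lemma socle_basis_card (V : lmodType R) (N : submodClosed V) (T : finType) (b : T -> V)
    :
  socle_basis N b -> socle_basis N (fun i : 'I_#|T| => b (enum_val i)).
Proof.
have re (c : T -> R) : \sum_t c t *: b t = \sum_(i < #|T|) c (enum_val i) *: b
    (enum_val i).
  by rewrite (reindex (@enum_val T T)) //; apply: onW_bij; apply: enum_val_bij.
move=> [b1 b2 b3]; split=> [i a am|v hv|c hc i]; first exact: b1.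
  by have [c hc] := b2 v hv; exists (fun i => c (enum_val i)); rewrite -re.
have := b3 (fun t => c (enum_rank t)); rewrite re.
under eq_bigr do rewrite enum_valK.
by move=> /(_ hc)/(_ (enum_val i)); rewrite enum_valK.
Qed.

Lemma socle_basis_ext (V : lmodType R) (N N' : submodClosed V) (T : finType) (b : T ->
    V) :
  N =i N' -> socle_basis N b -> socle_basis N' b.
Proof.
move=> e [b1 b2 b3]; split=> [t a am|v hv|c hc]; rewrite -?e; first exact: b1.
  have [|c hc] := b2 v; first by move=> a am; rewrite e hv.
  by exists c; rewrite -e.
by apply: b3; rewrite e.
Qed.

Local Notation k := {ideal_quot m}.

Definition residue (a : R) : k := (\pi_k a)%qT.

Local Notation p := residue.

Lemma residueM (a b : R) : residue (a * b) = residue a * residue b.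
Proof. exact: rmorphM. Qed.

Lemma residue_sum I (r : seq I) P (F : I -> R) :
  residue (\sum_(i <- r | P i) F i) = \sum_(i <- r | P i) residue (F i).
Proof. by apply: (big_morph residue) => [a b|]; [exact: rmorphD | exact: rmorph0]. Qed.

Lemma residue_eq0 (a : R) : (residue a == 0) = (a \in m).
Proof.
have <- : residue 0 = 0 by exact: rmorph0.
by rewrite -[a in RHS]subr0 Quotient.idealrBE.
Qed.

Lemma residue_repr (c : k) : residue (repr c) = c.
Proof. exact: reprK. Qed.

Lemma residue_nat (n : nat) : residue n%:R = n%:R.
Proof. exact: rmorph_nat. Qed.

(** Over the residue ring, [Bk *m Ak = 1%:M] gives [n <= n']; for square matrices the inverse is
    two-sided, so the spanning family is independent too. Equal dimensions thereby turn surjectivity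
    on socles into injectivity. *)
Lemma socle_basis_span (V : lmodType R) (N : submodClosed V) n n' (b : 'I_n -> V) (c :
    'I_n' -> V) :
  socle_basis N b -> (forall j a, a \in m -> a *: c j \in N) ->
  (forall i, exists r : 'I_n' -> R, b i - \sum_j r j *: c j \in N) ->
  (n <= n')%N /\ (n = n' -> forall r : 'I_n' -> R, \sum_j r j *: c j \in N -> forall j,
      r j \in m).
Proof.
move=> [b1 b2 b3] hc /choice[B hB].
have /choice[A hA] j : exists r : 'I_n -> R, c j - \sum_i r i *: b i \in N.
  by apply: b2 => a; apply: hc.
have push (r : 'I_n' -> R) :
    \sum_j r j *: c j - \sum_i (\sum_j r j * A j i) *: b i \in N.
  have -> : \sum_i (\sum_j r j * A j i) *: b i = \sum_j r j *: \sum_i A j i *: b i.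
    under eq_bigr do rewrite scaler_suml.
    rewrite exchange_big /=; apply: eq_bigr => j _; rewrite scaler_sumr.
    by apply: eq_bigr => i _; rewrite scalerA.
  by rewrite -sumrB; apply: rpred_sum => j _; rewrite -scalerBr rpredZ.
pose Ak : 'M[k]_(n', n) := \matrix_(j, i) p (A j i).
pose Bk : 'M[k]_(n, n') := \matrix_(i, j) p (B i j).
have BA : Bk *m Ak = 1%:M.
  apply/matrixP => i i'; rewrite !mxE.
  have h : \sum_i' ((i' == i)%:R - \sum_j B i j * A j i') *: b i' \in N.
    have := rpredD (hB i) (push (B i)); rewrite addrA subrK.
    have {1}-> : b i = \sum_i' (i' == i)%:R *: b i'.
      rewrite (bigD1 i) //= eqxx scale1r big1 ?addr0 // => j /negPf ->.
      by rewrite scale0r.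
    by rewrite -sumrB; under eq_bigr do rewrite -scalerBl.
  have := b3 _ h i'; rewrite Quotient.idealrBE => /eqP e.
  transitivity (p (\sum_j B i j * A j i')).
    by rewrite residue_sum; apply: eq_bigr => j _; rewrite !mxE residueM.
  by rewrite /residue -e -/(residue _) residue_nat eq_sym.
split; first exact: mulmx1_min BA.
move=> e; subst n' => r hr j.
have AB := mulmx1C BA.
pose rk : 'rV[k]_n := \row_j p (r j).
have rA : rk *m Ak = 0.
  apply/rowP => i; rewrite !mxE.
  have h : \sum_i (\sum_j r j * A j i) *: b i \in N.
    have := submodB hr (push r).
    by rewrite opprD addrA subrr add0r opprK.
  have /b3/(_ i) := h; rewrite -residue_eq0 => /eqP h0; apply: etrans h0.
  by rewrite residue_sum; apply: eq_bigr => j' _; rewrite !mxE residueM.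
have : rk = 0 by rewrite -[rk]mulmx1 -AB mulmxA rA mul0mx.
by move=> /rowP/(_ j); rewrite !mxE => /eqP; rewrite residue_eq0.
Qed.

Lemma socle_basis_unique (V : lmodType R) (N : submodClosed V) n n' (b : 'I_n -> V) (b'
    : 'I_n' -> V) :
  socle_basis N b -> socle_basis N b' -> n = n'.
Proof.
move=> hb hb'; have [b1 b2 _] := hb; have [b1' b2' _] := hb'; apply/eqP.
rewrite eqn_leq (socle_basis_span hb b1' _).1 ?(socle_basis_span hb' b1 _).1 //.
  by move=> i; apply: b2 => a; apply: b1'.
by move=> i; apply: b2' => a; apply: b1.
Qed.

Lemma socleP (L : lmodType R) z : z \in @socle R m L <-> forall a, a \in m -> a *: z =
    0.
Proof. by split=> [/asboolP|h]; last exact/asboolP. Qed.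

Lemma has_dim_socle_basis (L : lmodType R) n :
  has_dim (soc m L) n <-> exists b : 'I_n -> L, socle_basis (zeroS L) b.
Proof.
have vsum (c : 'I_n -> R) (b : 'I_n -> soc m L) :
    val (\sum_i p (c i) *: b i) = \sum_i c i *: val (b i).
  rewrite [LHS](raddf_sum (val : soc m L -> L)); apply: eq_bigr => i _; exact:
      soc_scaleE.
split=> [[b hb]|[b [b1 b2 b3]]].
  exists (fun i => val (b i)); split=> [t a am|v hv|c /zeroSP hc i].
  - by apply/zeroSP; have /socleP -> := valP (b t).
  - have vs : v \in @socle R m L by apply/socleP => a /hv/zeroSP.
    have [c [ec _]] := hb (Sub v vs); exists (fun i => repr (c i)).
    apply/zeroSP; rewrite -vsum.
    under eq_bigr do rewrite residue_repr.
    by rewrite -ec SubK subrr.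
  have [c0 [_ uc]] := hb 0.
  have e1 : c0 = [ffun=> 0].
    by apply: uc; rewrite big1 // => j _; rewrite ffunE scale0r.
  have e2 : c0 = [ffun i => p (c i)].
    apply: uc; apply: val_inj; under eq_bigr do rewrite ffunE.
    by rewrite vsum hc raddf0.
  by rewrite -residue_eq0; move/ffunP: e2 => /(_ i); rewrite e1 !ffunE => <-.
have bs i : b i \in @socle R m L by apply/socleP => a am; apply/zeroSP/b1.
pose bb i : soc m L := Sub (b i) (bs i).
have bbK i : val (bb i) = b i by exact: SubK.
exists bb => v.
have [|c hc] := b2 (val v).
  by move=> a am; apply/zeroSP; have /socleP := valP v; apply.
exists [ffun i => p (c i)]; split.
  apply: val_inj; under eq_bigr do rewrite ffunE.
  rewrite vsum; under eq_bigr do rewrite bbK.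
  by move/zeroSP: hc => /eqP; rewrite subr_eq0 => /eqP.
move=> c' ev; apply/ffunP => i; rewrite ffunE.
rewrite -[c' i]residue_repr; apply/eqP; rewrite -Quotient.idealrBE.
apply: (b3 (fun i => c i - repr (c' i))); apply/zeroSP.
under eq_bigr do rewrite scalerBl.
rewrite sumrB; move/zeroSP: hc => /eqP; rewrite subr_eq0 => /eqP <-.
apply/eqP; rewrite subr_eq0 ev; apply/eqP.
have -> : \sum_i c' i *: bb i = \sum_i p (repr (c' i)) *: bb i.
  by apply: eq_bigr => j _; rewrite residue_repr.
by rewrite vsum; apply: eq_bigr => j _; rewrite bbK.
Qed.

Lemma basis_dim_socle_basis (L : lmodType R) n (b : 'I_n -> L) : socle_basis (zeroS L)
    b ->
  basis_dim (soc m L) = n.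
Proof.
move=> hb; apply: classical_sets.xget_unique; first by apply/has_dim_socle_basis;
    exists b.
by move=> n' /has_dim_socle_basis[b' hb']; apply: socle_basis_unique hb' hb.
Qed.

(** Only the map induced on socles has to be bijective, so that this applies to [ltop x 0], which
    need not be surjective. *)
Lemma socle_basis_iso (V L : lmodType R) (N : submodClosed V) (N' : submodClosed L)
    (f : {linear V -> L}) (T : finType) (b : T -> V) :
  (forall v, f v \in N' -> (forall a, a \in m -> a *: v \in N) -> v \in N) ->
  (forall v, v \in N -> f v \in N') ->
  (forall z, (forall a, a \in m -> a *: z \in N') ->
     exists v, (forall a, a \in m -> a *: v \in N) /\ z - f v \in N') ->
  socle_basis N b -> socle_basis N' (f \o b).
Proof.
move=> finj NN' fsurj [b1 b2 b3]; split=> [t a am|z /fsurj[v [/b2[c hc] hz]]|c hc].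
- by rewrite /= -linearZ; apply/NN'/b1.
- exists c; have -> : z - \sum_t c t *: (f \o b) t = (z - f v) + f (v - \sum_t c t *: b
    t).
    rewrite linearB (linear_sum f) /= addrA subrK; congr (_ - _).
    by apply: eq_bigr => t _; rewrite linearZ.
  by rewrite rpredD // NN'.
apply: b3; apply: finj; first by rewrite (linear_sum f); under eq_bigr do rewrite
    linearZ.
move=> a am; rewrite scaler_sumr; apply: rpred_sum => t _.
by rewrite scalerA mulrC -scalerA rpredZ // b1.
Qed.

Section Reducibility.
Hypotheses (noethR : noethmod R^o) (localR : local_ring m).
Variable V : lmodType R.
Hypothesis noethV : noethmod V.
Implicit Types N : submodClosed V.

(** Each component contributes a socle element that lies in all other components but not in its own;
    irredundance and [socle_elt] provide it. A socle element of [V / N] is determined by its classes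
    modulo the [F i], each of which is a multiple of the class of [b i]. *)
Lemma irredundant_socle_basis N r (F : 'I_r -> submodClosed V) : mprim m N ->
  irredundant_decomposition N F -> exists b : 'I_r -> V, socle_basis N b.
Proof.
move=> hN [irrF NF irrd].
have NFi i : {subset N <= F i} by move=> v /NF.
have /choice[b hb] j : exists v, [/\ forall i, i != j -> v \in F i, v \notin F j &
    forall a, a \in m -> a *: v \in N].
  have [w [wF wN]] : exists w, (forall i, i != j -> w \in F i) /\ w \notin N.
    apply: contrapT => no; apply: (irrd j) => v; split=> [/NF h i _|h]; first exact: h.
    by apply: contrapT => /negP vN; apply: no; exists v.
  have [c [cN mc]] := socle_elt noethR hN wN.
  have cF i : i != j -> c *: w \in F i by move=> /wF; apply: rpredZ.
  exists (c *: w); split=> //; apply: contra cN => cwj; apply/NF => i.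
  by case: (eqVneq i j) => [->//|/cF].
exists b; split=> [t a|w mw|c hc i]; first by case: (hb t) => _ _; apply.
  have /choice[c hc] i : exists c : R, w - c *: b i \in F i.
    case: (boolP (w \in F i)) => [wF|wF]; first by exists 0; rewrite scale0r subr0.
    have [_ bF mb] := hb i.
    (* The socle of [V / F i] is one-dimensional: by irreducibility, two submodules properly above
       [F i] share an element outside [F i]. Its coefficient at [w] is a unit, as [m] kills [w]
       modulo [F i]. *)
    have [u [/addvP[f [a [fF eu]]] /addvP[f' [a' [f'F eu']]] uF]] : exists u,
        [/\ u \in addv (F i) (b i), u \in addv (F i) w & u \notin F i].
      apply: contrapT => no; apply: (irrF i); exists (addv (F i) (b i)), (addv (F i) w).
      split=> [||v].
      - split=> [v|sub]; first exact: addvl.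
        by move/negP: bF; apply; apply/sub/addvr.
      - split=> [v|sub]; first exact: addvl.
        by move/negP: wF; apply; apply/sub/addvr.
      apply/idP/andP => [vF|[v1 v2]]; first by split; apply: addvl.
      by apply: contrapT => /negP vF; apply: no; exists v.
    have a'm : a' \notin m.
      by apply: contra uF => /mw/(NFi i) a'w; rewrite eu' rpredD.
    have [r0 er] := local_unit noethR localR a'm; exists (r0 * a).
    have -> : w - (r0 * a) *: b i = r0 *: (f - f').
      apply/eqP; rewrite subr_eq; apply/eqP.
      rewrite -scalerA -scalerDr addrAC -eu eu' addrC addKr scalerA er.
      by rewrite scale1r.
    by rewrite rpredZ // submodB.
  exists c; apply/NF => i; rewrite (bigD1 i) //= opprD addrA; apply: submodB => //.
  by apply: rpred_sum => j ji; case: (hb j) => /(_ i) h _ _; rewrite rpredZ // h //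
      eq_sym.
have [_ bF _] := hb i; apply: contraNT bF => ci.
have : c i *: b i \in F i.
  move/(NFi i): hc; rewrite (bigD1 i) //= addrC submod_addl //.
  by apply: rpred_sum => j ji; case: (hb j) => /(_ i) h _ _; rewrite rpredZ // h //
      eq_sym.
have [r0 er] := local_unit noethR localR ci.
by move/(@rpredZ _ _ (F i) r0); rewrite scalerA er scale1r.
Qed.

(** A decomposition with the least number of components is irredundant. *)
Lemma exists_irredundant N : exists r (F : 'I_r -> submodClosed V),
  irredundant_decomposition N F.
Proof.
pose dec N r := exists F : 'I_r -> submodClosed V,
  (forall i, irreducible_submod (F i)) /\ forall v, v \in N <-> forall i, v \in F i.
have exdec : exists r, dec N r.
  apply: contrapT => nN.
  have [|{nN}B [nB maxB]] := noethV (F := fun B => ~ exists r, dec B r); first by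
      exists N.
  have /contrapT[N1 [N2 [[B1 nB1] [B2 nB2] e]]] : ~ irreducible_submod B.
    move=> irr; apply: nB; exists 1%N, (fun=> B); split=> // v.
    by split=> // /(_ ord0).
  have good N' : {subset B <= N'} -> ~ {subset N' <= B} -> exists r, dec N' r.
    by move=> BN' nBN'; apply: contrapT => no; apply: nBN'; apply: maxB.
  have [r [F [irrF FP]]] := good _ B1 nB1; have [s [G [irrG GP]]] := good _ B2 nB2.
  apply: nB; exists (r + s)%N.
  exists (fun i => match split i with inl j => F j | inr j => G j end).
  split=> [i|v]; first by case: split.
  rewrite e; split=> [/andP[/FP h1 /GP h2] i|h]; first by case: split.
  apply/andP; split; [apply/FP|apply/GP] => j.
    by have := h (unsplit (inl j)); rewrite unsplitK.
  by have := h (unsplit (inr j)); rewrite unsplitK.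
have exdecb : exists r, `[< dec N r >] by have [r h] := exdec; exists r; apply/asboolP.
case: (ex_minnP exdecb) => r /asboolP[F [irrF FP]] minr.
exists r, F; split=> // j nj.
case: r F irrF FP minr j nj => [|r] F irrF FP minr j nj; first by case: j {nj}.
suff : (r.+1 <= r)%N by rewrite ltnn.
apply: minr; apply/asboolP; exists (fun i => F (lift j i)); split=> // v.
rewrite nj; split=> [h i|h i]; first by apply: h; rewrite eq_sym neq_lift.
by case: (unliftP j i) => [i' ->|->]; [move=> _; apply: h | rewrite eqxx].
Qed.

Lemma index_reducibilityE N (T : finType) (b : T -> V) : mprim m N -> socle_basis N b ->
  index_reducibility N = #|T|.
Proof.
move=> hN /socle_basis_card hb; apply: classical_sets.xget_unique.
  have [r [F hF]] := exists_irredundant N; have [b' hb'] := irredundant_socle_basis hN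
      hF.
  by have -> := socle_basis_unique hb hb'; exists F.
by move=> r [F /(irredundant_socle_basis hN)[b' hb']]; apply: socle_basis_unique hb' hb.
Qed.

Lemma exists_socle_basis N : mprim m N -> exists n (b : 'I_n -> V), socle_basis N b.
Proof.
move=> hN; have [r [F hF]] := exists_irredundant N.
by have [b hb] := irredundant_socle_basis hN hF; exists r, b.
Qed.

Lemma index_reducibility_ext (N N' : {pred V}) : N =i N' ->
  index_reducibility N = index_reducibility N'.
Proof.
move=> e; rewrite /index_reducibility; congr (classical_sets.xget _ _).
apply/funext => r; apply/propext; split=> -[F [h1 h2 h3]]; exists F; split=> //.
- by move=> v; rewrite -e.
- by move=> j h; apply: (h3 j) => v; rewrite e; apply: h.
- by move=> v; rewrite e.
by move=> j h; apply: (h3 j) => v; rewrite -e; apply: h.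
Qed.

End Reducibility.
End SocleBases.

(** * Top Koszul cohomology and its limit *)

Section TopKoszul.
Variables (R : comNzRingType) (M : lmodType R) (d : nat).
Implicit Types (x : 'I_d -> R) (u v w : M) (J : {set 'I_d}).

Definition top_cochain v : kcochain M d := [ffun J : {set 'I_d} => if J == [set: 'I_d]
    then v else 0].

Fact top_cochain_linear : linear top_cochain.
Proof.
move=> a u v; apply/ffunP => J; rewrite !ffunE.
by case: ifP => _ //; rewrite scaler0 addr0.
Qed.

Lemma setT_card J : (#|J| == d) = (J == [set: 'I_d]).
Proof.
apply/eqP/eqP => [cJ|->]; last by rewrite cardsT card_ord.
by apply/eqP; rewrite eqEcard subsetT cardsT card_ord cJ leqnn.
Qed.

Fact top_cochain_cocycle x v : top_cochain v \in kcocycle x d.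
Proof.
apply/andP; split.
  by apply/kdegP => J; rewrite setT_card ffunE => /negPf ->.
apply/eqP/ffunP => J; rewrite !ffunE big1 // => j jJ; rewrite ffunE.
case: eqP => [e|]; last by rewrite scaler0.
by have : j \in J :\ j; [rewrite e inE | rewrite !inE eqxx].
Qed.

Definition topZ x v : kZ M x d := Sub (top_cochain v) (top_cochain_cocycle x v).

Lemma topZ_surj x (f : kZ M x d) : f = topZ x (val f setT).
Proof.
apply: val_inj; apply/ffunP => J; rewrite SubK ffunE.
have /andP[/kdegP hf _] := valP f.
by case: eqP => [->//|/eqP]; rewrite -setT_card => /hf.
Qed.

Lemma topZ_coboundary x v : topZ x v \in @kcoboundary R M d x d <-> v \in gensub M x
    xpredT.
Proof.
split=> [/asboolP[g [hg]]|].
  rewrite SubK => /ffunP/(_ setT); rewrite !ffunE eqxx => ->.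
  by apply: rpred_sum => j _; rewrite mulrC -scalerA; apply: mem_gensub.
have topZD a u w : topZ x (a *: u + w) = a *: topZ x u + topZ x w.
  by apply: val_inj; rewrite linearP !SubK /= top_cochain_linear.
have topZ0 : topZ x 0 = 0.
  by apply: val_inj; apply/ffunP => J; rewrite !ffunE; case: ifP.
apply: (span_ind (P := fun v => topZ x v \in @kcoboundary R M d x d)).
  split=> [|a u w hu hw]; last by rewrite topZD rpredD // rpredZ.
  by rewrite topZ0; apply: rpred0.
move=> _ [i [u [_ ->]]]; apply/asboolP.
(* The exponent of the sign with which [kdiff] takes the complement of [i] to the full set; putting
   the same sign into the witness cancels it. *)
pose e := #|[set k in [set: 'I_d] | (k < i)%N]|.
exists [ffun J : {set 'I_d} => if J == [set~ i] then (-1) ^+ e *: u else 0]; split.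
  move=> J; rewrite ffunE; case: (eqVneq J [set~ i]) => [->|//].
  by rewrite cardsC1 card_ord prednK ?eqxx //; apply: leq_ltn_trans (ltn_ord i).
rewrite SubK; apply/ffunP => J; rewrite !ffunE.
case: eqP => [->|/eqP JT].
  rewrite (bigD1 i) ?inE //= ffunE setTD eqxx scalerA big1 ?addr0.
    by rewrite mulrAC -exprD addnn -signr_odd odd_double mul1r.
  move=> j /andP[_ ji]; rewrite ffunE; case: eqP => [/setP/(_ i)|]; last by rewrite
      scaler0.
  by rewrite !inE eqxx eq_sym ji.
rewrite big1 // => j jJ; rewrite ffunE; case: eqP => [e'|]; last by rewrite scaler0.
case/negP: JT; apply/eqP/setP => k; rewrite !inE.
have := congr1 (fun A : {set 'I_d} => j \in A) e'; rewrite !inE eqxx /= =>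
    /esym/negbFE/eqP ji.
have := congr1 (fun A : {set 'I_d} => k \in A) e'; rewrite !inE -ji.
by case: (eqVneq k j) => [->|].
Qed.

Definition ktop x v : koszulH M x d := kclass (topZ x v).

Fact ktop_linear x : linear (ktop x).
Proof.
move=> a u v; rewrite /ktop -kclass_linear; congr kclass.
by apply: val_inj; rewrite linearP !SubK /= top_cochain_linear.
Qed.

HB.instance Definition _ x :=
  GRing.isLinear.Build R M (koszulH M x d) *:%R (ktop x) (ktop_linear x).

Lemma ktop_surj x (h : koszulH M x d) : exists v, h = ktop x v.
Proof.
by have [f ->] := kclass_surj h; exists (val f setT); rewrite /ktop -topZ_surj.
Qed.

Lemma ktop_eq0 x v : ktop x v = 0 <-> v \in gensub M x xpredT.
Proof.
rewrite -topZ_coboundary -[0 in X in X <-> _](raddf0 (@kclass R M d x d)).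
by rewrite -[in X in _ <-> X](subr0 (topZ x v)); apply: quotmod_piE.
Qed.

Lemma kmap_top x s t (le_st : (s <= t)%N) v :
  kmap le_st (ktop (xpow x s) v) = ktop (xpow x t) ((\prod_j x j ^+ (t - s)) *: v).
Proof.
rewrite /ktop kmap_class; congr kclass; apply: val_inj; apply/ffunP => J.
rewrite !SubK !ffunE; case: eqP => [->|_]; last by rewrite scaler0.
by congr (_ *: _); apply: eq_bigl => j; rewrite inE.
Qed.

(** Stage [t] of the system is the quotient by the powers [x j ^+ t.+1]. *)
Definition ltop x t v : koszul_lim M x d :=
  @dlim_in R (koszul_sys M x d) t (ktop (xpow x t.+1) v).

Fact ltop_linear x t : linear (ltop x t).
Proof.
move=> a u v; rewrite /ltop -dlim_in_linear; congr dlim_in; exact: ktop_linear.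
Qed.

HB.instance Definition _ x t :=
  GRing.isLinear.Build R M (koszul_lim M x d) *:%R (ltop x t) (ltop_linear x t).

Lemma ltop_raise x t s v : ltop x (t + s) ((\prod_j x j ^+ s) *: v) = ltop x t v.
Proof.
rewrite /ltop -[RHS](dlim_in_map (D := koszul_sys M x d) (leq_addr s t)).
congr dlim_in; apply/esym; etransitivity; first exact: kmap_top.
by rewrite subSS addKn.
Qed.

Lemma ltop_surj x (z : koszul_lim M x d) : exists t v, z = ltop x t v.
Proof.
by have [t [h ->]] := dlim_surj z; have [v ->] := ktop_surj h; exists t, v.
Qed.

Lemma ltop_eq0 x t v :
  ltop x t v = 0 <->
  exists s, (\prod_j x j ^+ s) *: v \in gensub M (xpow x (t + s).+1) xpredT.
Proof.
split=> [|[s hs]]; last first.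
  rewrite -(ltop_raise x t s) /ltop; have /ktop_eq0 -> := hs.
  exact: (raddf0 (@dlim_in R (koszul_sys M x d) (t + s))).
rewrite -(raddf0 (@dlim_in R (koszul_sys M x d) t)) => /dlim_inE[u [le_tu [le_tu' e]]].
have su : (t + (u - t))%N = u by rewrite subnKC.
exists (u - t)%N; rewrite su; apply/ktop_eq0.
have := @kmap_top x t.+1 u.+1 le_tu v; rewrite subSS => <-.
by apply: etrans e _; apply: (raddf0 (@dmap R (koszul_sys M x d) t u le_tu')).
Qed.

Lemma soc_surjective_top (m : idealr R) x :
  soc_surjective m (@koszul_to_lim R M d x d) ->
  forall z : koszul_lim M x d, (forall a, a \in m -> a *: z = 0) ->
  exists v, (forall a, a \in m -> a *: v \in gensub M x xpredT) /\ z = ltop x 0 v.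
Proof.
move=> hs z hz; have [|y /socleP my <-] := hs z; first exact/socleP.
have [v ev] := ktop_surj y; exists v; rewrite ev; split=> // a am.
by apply/ktop_eq0; rewrite linearZ /= -ev my.
Qed.

End TopKoszul.

(** * Changing one parameter at a time *)

Section ChangeOfParameters.
Variables (R : comNzRingType) (m : idealr R).
Hypotheses (noethR : noethmod R^o) (localR : local_ring m).
Variable M : lmodType R.
Hypothesis noethM : noethmod M.
Variable d : nat.
Implicit Types (x z : 'I_d -> R) (u v w : M).

Definition update x i c : 'I_d -> R := fun j => if j == i then c else x j.

Lemma update_id x i : update x i (x i) = x.
Proof. by apply/funext => j; rewrite /update; case: eqP => [->|]. Qed.

Lemma update_update x i c c' : update (update x i c) i c' = update x i c'.
Proof. by apply/funext => j; rewrite /update; case: eqP. Qed.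

Lemma updateE x i c : update x i c i = c.
Proof. by rewrite /update eqxx. Qed.

Lemma gensub_update x i c n : gensub M (xpow (update x i c) n) (predC1 i) =i gensub M
    (xpow x n) (predC1 i).
Proof.
move=> v; apply/idP/idP; apply: span_sub => _ [j [u [/= ji ->]]];
  [have e : xpow (update x i c) n j = xpow x n j | have e : xpow x n j = xpow (update x
      i c) n j];
  try by rewrite /xpow /update (negPf ji).
all: by rewrite e; apply: mem_gensub.
Qed.

Lemma xpow1 x : xpow x 1 = x.
Proof. by apply/funext => j; rewrite /xpow expr1. Qed.

Lemma gensub_update_addm x i c n :
  gensub M (xpow (update x i c) n) xpredT =i addm (gensub M (xpow x n) (predC1 i)) (c
      ^+ n).
Proof.
move=> v; rewrite -(gensub_addm (xpow (update x i c) n) i) (addm_ext _ (gensub_update x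
    i c n)).
by rewrite /xpow updateE.
Qed.

Definition param x : Prop := (forall j, x j \in m) /\ mprim m (gensub M x xpredT).

Lemma mprim_ext (N N' : submodClosed M) : N =i N' -> mprim m N -> mprim m N'.
Proof. by move=> e; apply: mprim_sub => v; rewrite e. Qed.

Lemma powsub_mprim_pow x a k n : (forall v, a ^+ k *: v \in gensub M x xpredT) ->
  forall v, a ^+ (k * n) *: v \in powsub M x n.
Proof.
move=> h; elim: n => [|n IH] v.
  by rewrite muln0 -[X in X \in _]scale1r -(mon0 x); apply: mem_monspan; rewrite big1.
rewrite mulnS exprD -scalerA.
apply: (span_ind (P := fun w => a ^+ k *: w \in powsub M x n.+1) _ _ (IH v)).
  split=> [|c u w hu hw]; first by rewrite scaler0 rpred0.
  by rewrite scalerDr scalerA mulrC -scalerA rpredD // rpredZ.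
by move=> _ [e [u [en ->]]]; rewrite scalerA mulrC -scalerA; apply: mon_gensub.
Qed.

Lemma mprim_powsub x n : mprim m (gensub M x xpredT) -> mprim m (powsub M x n).
Proof. by move=> h a /h[k /powsub_mprim_pow hk]; exists (k * n)%N. Qed.

Lemma param_xpow x n : param x -> param (xpow x n.+1).
Proof.
move=> [xm hx]; split=> [j|].
  by rewrite /xpow exprSr idealMr.
(* A monomial of degree [(d * n).+1] has an exponent greater than [n]. *)
apply: mprim_sub (mprim_powsub (d * n).+1 hx) => v; apply: span_sub => _ [e [u
    [/pigeonhole[j hj] ->]]].
exact: mon_xpow hj.
Qed.

Lemma param_update x i c : param (update x i c) -> c \in m /\
  forall n, mprim m (addm (gensub M (xpow x n.+1) (predC1 i)) c).
Proof.
move=> hp; split=> [|n]; first by have := hp.1 i; rewrite updateE.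
have [_ /(mprim_ext (gensub_update_addm x i c n.+1))] := param_xpow n hp.
apply: mprim_sub => v /addmP[w [u [wN ->]]]; apply/addmP; exists w, (c ^+ n *: u).
by rewrite scalerA -exprS.
Qed.

Lemma param_update_intro x i c : (forall j, x j \in m) -> c \in m ->
  mprim m (addm (gensub M x (predC1 i)) c) -> param (update x i c).
Proof.
move=> xm cm hc; split=> [j|]; first by rewrite /update; case: eqP.
apply: mprim_ext hc => v; have := gensub_update_addm x i c 1 v.
by rewrite !xpow1 expr1.
Qed.

(* A common parameter [c] can replace [x i] in [x] and [z i] in [z], which lowers
   the number of indices where the two systems differ. *)
Lemma param_connected (P : ('I_d -> R) -> Prop) :
  (forall x i c, param x -> param (update x i c) -> P x -> P (update x i c)) ->
  forall x z, param x -> param z -> P x -> P z.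
Proof.
move=> step x z; elim: {x z}_.+1 {-2}x {-2}z (ltnSn #|[set i | x i != z i]|) => // n IH
    x z.
rewrite ltnS => card px pz Px.
have [e|[i]] := set_0Vmem [set i | x i != z i].
  suff -> : z = x by [].
  apply/funext => i; apply/eqP; rewrite eq_sym -[_ == _]negbK; apply/negP => h.
  by have := in_set0 i; rewrite -e inE h.
rewrite inE => xzi.
have [|xim hx] := @param_update x i (x i); first by rewrite update_id.
have [|zim hz] := @param_update z i (z i); first by rewrite update_id.
have := hx 0%N; have := hz 0%N; rewrite !xpow1 => hz1 hx1.
have [c [cm hxc hzc]] := common_parameter noethR localR noethM xim zim hx1 hz1.
have pxc := param_update_intro px.1 cm hxc; have pzc := param_update_intro pz.1 cm hzc.
have : P (update z i c).
  apply: (IH (update x i c)) => //; last exact: step.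
  apply: leq_trans card; apply: proper_card; apply/properP; split.
    by apply/subsetP => j; rewrite !inE /update; case: ifP => // _; rewrite eqxx.
  by exists i; rewrite !inE // !updateE eqxx.
move/(step _ i (z i) pzc); rewrite update_update update_id; exact.
Qed.

Lemma limit_closed_wregular x (s : seq 'I_d) : (forall j, x j \in m) -> uniq s ->
  limit_closed M x -> wregular (zeroS M) [seq x j | j <- s].
Proof.
move=> xm us hx; apply: (@wregular_take _ _ _ _ 0) => k; rewrite size_map => ks.
have [j0 _] : exists j, j \in s by case: s ks {us} => // j s _; exists j; rewrite
    mem_head.
rewrite (nth_map j0) // -map_take.
apply: (nzd_ext (fun v => esym (seqsub_zero x (take k s) v))).
apply: (limit_closed_nzd noethR localR noethM xm hx).
by rewrite -[_ (nth _ _ _)]/(nth j0 s k \in take k s) in_take_leq ?index_uniq ?ltnn //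
    ltnW.
Qed.

Lemma prod_all (s : seq 'I_d) (F : 'I_d -> R) : uniq s -> (forall j, j \in s) ->
  \prod_(j <- s) F j = \prod_j F j.
Proof.
move=> us hs; apply: perm_big; apply: uniq_perm => //; first exact: index_enum_uniq.
by move=> j; rewrite hs mem_index_enum.
Qed.

Lemma seqsub_all x (s : seq 'I_d) : (forall j, j \in s) ->
  seqsub (zeroS M) [seq x j | j <- s] =i gensub M x xpredT.
Proof.
by move=> hs v; rewrite seqsub_zero; apply: gensub_ext => j; apply: hs.
Qed.

Lemma wregular_limit_closed x (s : seq 'I_d) : uniq s -> (forall j, j \in s) ->
  wregular (zeroS M) [seq x j | j <- s] -> limit_closed M x.
Proof.
move=> us hs ws t v; rewrite -(prod_all (fun j => x j ^+ t) us hs) -(seqsub_all (xpow x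
    t.+1) hs) => h.
rewrite -(seqsub_all x hs); have := wregular_cancel (n := 0) ws h.
by rewrite (eq_map (g := x)) // => j; rewrite expr1.
Qed.

(** Modulo the other parameters, [c]-torsion is [x i]-torsion by [mprim_torsion], hence zero. The
    unchanged parameters form a regular sequence, and [c] is put at its end. *)
Lemma limit_closed_update x i c : param x -> param (update x i c) ->
  limit_closed M x -> limit_closed M (update x i c).
Proof.
move=> px pxc hx; have [cm /(_ 0%N)] := param_update pxc; rewrite xpow1 => hc.
set N := gensub M x (predC1 i) in hc.
have nxi : nzd N (x i) by apply: (limit_closed_nzd noethR localR noethM px.1 hx);
    rewrite /= eqxx.
have nc : nzd N c.
  move=> u cu; have [k hk] := mprim_torsion noethM (n := 1) hc (px.1 i) cu.
  exact: (nzdX (k := k) nxi).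
pose s := [seq j <- enum 'I_d | j != i].
have us : uniq s by rewrite filter_uniq ?enum_uniq.
have sE j : (j \in s) = (j != i) by rewrite mem_filter mem_enum andbT.
apply: (@wregular_limit_closed _ (rcons s i)).
- by rewrite rcons_uniq us sE eqxx.
- by move=> j; rewrite mem_rcons inE sE; case: eqP.
rewrite map_rcons updateE.
have -> : [seq update x i c j | j <- s] = [seq x j | j <- s].
  by apply/eq_in_map => j; rewrite sE /update => /negPf ->.
apply: wregular_rcons; first exact: limit_closed_wregular px.1 us hx.
apply: nzd_ext nc => v; rewrite seqsub_zero; apply: gensub_ext => j.
exact: (esym (sE j)).
Qed.

End ChangeOfParameters.

(** * The socle of the limit *)

Section LimitIso.
Variables (R : comNzRingType) (m : idealr R).

Definition soc_has_basis (L : lmodType R) n : Prop :=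
  exists b : 'I_n -> L, socle_basis m (zeroS L) b.

Lemma soc_has_basis_bij (L L' : lmodType R) (f : {linear L -> L'}) n :
  (forall z, f z = 0 -> z = 0) -> (forall z', exists z, f z = z') ->
  soc_has_basis L n <-> soc_has_basis L' n.
Proof.
move=> finj fsurj; split=> [[b hb]|[b [b1 b2 b3]]].
  exists (f \o b); apply: (socle_basis_iso (f := f)) hb => [v /zeroSP/finj -> _|v
      /zeroSP ->|z hz].
  - exact: rpred0.
  - by rewrite raddf0 rpred0.
  have [v ev] := fsurj z; exists v; rewrite ev subrr rpred0; split=> // a am.
  by apply/zeroSP/finj; rewrite linearZ /= ev; apply/zeroSP/hz.
have /choice[b' hb'] i := fsurj (b i).
have fsum (c : 'I_n -> R) : f (\sum_i c i *: b' i) = \sum_i c i *: b i.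
  by rewrite linear_sum; apply: eq_bigr => i _; rewrite linearZ /= hb'.
exists b'; split=> [t a am|v hv|c /zeroSP hc].
- by apply/zeroSP/finj; rewrite linearZ /= hb'; apply/zeroSP/b1.
- have [a am|c /zeroSP hc] := b2 (f v).
    by rewrite -linearZ; move/zeroSP: (hv a am) => ->; rewrite raddf0 rpred0.
  by exists c; apply/zeroSP/finj; rewrite raddfB /= fsum hc.
by apply: b3; rewrite -fsum hc raddf0 rpred0.
Qed.

Hypotheses (noethR : noethmod R^o) (localR : local_ring m).
Variable M : lmodType R.
Hypothesis noethM : noethmod M.
Variable d : nat.
Implicit Types (x z : 'I_d -> R) (u v w : M).

Lemma prod_update x i c s : \prod_j update x i c j ^+ s = c ^+ s * \prod_(j | j != i) x
    j ^+ s.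
Proof.
rewrite (bigD1 i) //= updateE; congr (_ * _).
by apply: eq_bigr => j; rewrite /update => /negPf ->.
Qed.

Lemma prod_split x i s : \prod_j x j ^+ s = x i ^+ s * \prod_(j | j != i) x j ^+ s.
Proof. exact: bigD1. Qed.

Lemma gensub_split x i n : gensub M (xpow x n) xpredT =i
  addm (gensub M (xpow x n) (predC1 i)) (x i ^+ n).
Proof. by move=> v; rewrite -(gensub_addm (xpow x n) i). Qed.

Lemma prod_gensub x i n k u : u \in gensub M (xpow x n) (predC1 i) ->
  (\prod_(j | j != i) x j ^+ k) *: u \in gensub M (xpow x (n + k)) (predC1 i).
Proof.
apply: (span_ind (P := fun u => (\prod_(j | j != i) x j ^+ k) *: u \in
  gensub M (xpow x (n + k)) (predC1 i))).
  split=> [|c v w hu hw]; first by rewrite scaler0 rpred0.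
  by rewrite scalerDr scalerA mulrC -scalerA rpredD // rpredZ.
move=> _ [j [v [/= ji ->]]]; rewrite (bigD1 j) //= /xpow scalerA.
rewrite mulrAC -exprD [(k + n)%N]addnC -scalerA.
exact: (@mem_gensub _ _ _ (xpow x (n + k))).
Qed.

(* The isomorphism is induced by multiplication by [b ^+ t], from
   [M / (x_1^t, ..., x_d^t) M] to the quotient where [x_i^t] becomes [(x_i b)^t]. *)
Lemma lim_update_mul x i b n : param m M x -> param m M (update x i b) ->
  soc_has_basis (koszul_lim M x d) n <->
  soc_has_basis (koszul_lim M (update x i (x i * b)) d) n.
Proof.
move=> [xm hx] hxb; have [bm hb] := param_update hxb; set x' := update x i (x i * b).
pose Y k := gensub M (xpow x k) (predC1 i).
have xsub' k : gensub M (xpow x' k) xpredT =i addm (Y k) ((x i * b) ^+ k).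
  exact: gensub_update_addm.
have prod' s : \prod_j x' j ^+ s = b ^+ s * \prod_j x j ^+ s.
  by rewrite prod_update (prod_split x i) exprMn mulrA [b ^+ s * _]mulrC.
have push k u : u \in gensub M (xpow x k) xpredT ->
    b ^+ k *: u \in gensub M (xpow x' k) xpredT.
  rewrite (gensub_split x i) xsub' => /addmP[y [w [yY ->]]]; apply/addmP.
  exists (b ^+ k *: y), w; rewrite rpredZ //; split=> //.
  by rewrite scalerDr scalerA exprMn [b ^+ k * _]mulrC.
have /choice[rep hrep] (p : koszul_lim M x d) : exists tv : nat * M, p = ltop x tv.1
    tv.2.
  by have [t [v ->]] := ltop_surj p; exists (t, v).
pose f p := ltop x' (rep p).1 (b ^+ (rep p).1.+1 *: (rep p).2).
have push0 t u : ltop x t u = 0 -> ltop x' t (b ^+ t.+1 *: u) = 0.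
  move=> /ltop_eq0[s hs]; apply/ltop_eq0; exists s.
  have := push _ _ hs; rewrite prod' !scalerA => h.
  by rewrite mulrAC -exprD addnS [(s + t)%N]addnC.
have raise' t s u : ltop x' t (b ^+ t.+1 *: u) =
    ltop x' (t + s) (b ^+ (t + s).+1 *: ((\prod_j x j ^+ s) *: u)).
  rewrite -(ltop_raise x' t s) prod' !scalerA; congr (ltop _ _ (_ *: _)).
  by rewrite mulrAC -exprD addnS [(s + t)%N]addnC.
have fE t v : f (ltop x t v) = ltop x' t (b ^+ t.+1 *: v).
  have e := hrep (ltop x t v); rewrite /f.
  move: (rep (ltop x t v)) e => [s w] /= e.
  rewrite (raise' t s) (raise' s t) [(s + t)%N]addnC; apply/eqP.
  rewrite -subr_eq0 -raddfB -scalerBr; apply/eqP/push0.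
  rewrite raddfB /= ltop_raise e -[(t + s)%N]addnC ltop_raise.
  by rewrite subrr.
have flin : linear f.
  move=> a p q; have [t [u ->]] := ltop_surj p; have [s [v ->]] := ltop_surj q.
  rewrite -(ltop_raise x t s) -(ltop_raise x s t) [(s + t)%N]addnC.
  move: (_ *: u) (_ *: v) => {}u {}v; rewrite -linearP !fE -[RHS]linearP.
  by congr (ltop _ _ _); rewrite scalerDr !scalerA mulrC.
pose F : {linear koszul_lim M x d -> koszul_lim M x' d} :=
  HB.pack f (GRing.isLinear.Build _ _ _ _ f flin).
apply: (soc_has_basis_bij (f := F)) => [p|p].
  have [t [v ->]] := ltop_surj p; rewrite /= fE => /ltop_eq0[s].
  set k := (t + s).+1; rewrite prod' xsub' => /addmP[y [w [yY e]]].
  (* Injectivity: [b ^+ k] takes [u] into [Y k], so some [x i ^+ j] does too, and passing [j] stages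
     further in the limit supplies this power. *)
  pose u := (\prod_j x j ^+ s) *: v - x i ^+ k *: w.
  have bu : b ^+ k *: u \in Y k.
    have -> : b ^+ k *: u = y; last exact: yY.
    apply: (addIr ((x i * b) ^+ k *: w)); rewrite -e /u scalerBr !scalerA.
    rewrite exprMn [x i ^+ k * _]mulrC subrK; congr (_ *: _).
    by rewrite mulrAC -exprD addnS [(s + t)%N]addnC.
  have [j hj] := mprim_torsion noethM (hb (t + s)%N) (xm i) bu.
  apply/ltop_eq0; exists (s + j)%N; rewrite addnA -addSn -/k (gensub_split x i).
  apply/addmP; exists ((\prod_(j0 | j0 != i) x j0 ^+ j) *: (x i ^+ j *: u)).
  exists ((\prod_(j0 | j0 != i) x j0 ^+ j) *: w); split; first exact: prod_gensub.
  rewrite /u !scalerA scalerBr !scalerA.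
  have -> : \prod_j0 x j0 ^+ (s + j) =
      (\prod_j0 x j0 ^+ s) * (x i ^+ j * \prod_(j0 | j0 != i) x j0 ^+ j).
    by rewrite -prod_split -big_split; apply: eq_bigr => j0 _; rewrite exprD.
  move: (\prod_(j0 | j0 != i) x j0 ^+ j) (\prod_j0 x j0 ^+ s) => A B.
  have -> : x i ^+ (k + j) * A = A * x i ^+ j * x i ^+ k by rewrite exprD; ring.
  by rewrite subrK; congr (_ *: _); ring.
have [t [v ->]] := ltop_surj p.
(* Surjectivity: modulo [Y t.+1], some [x i ^+ k] makes [v] a multiple of [b ^+ t.+1]. Passing [k]
   stages further supplies [x i ^+ k], together with the [b ^+ k] that completes the exponent
   [(t + k).+1]. *)
have [k hk] := mprim_addm_pow t.+1 (hb t) (xm i).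
have /addmP[y [w [yY e]]] := hk v.
set A := \prod_(j | j != i) x j ^+ k.
exists (ltop x (t + k) (A *: w)).
rewrite /= fE -(ltop_raise x' t k) prod' (prod_split x i) -/A.
have -> : (b ^+ k * (x i ^+ k * A)) *: v =
    b ^+ (t + k).+1 *: (A *: w) + b ^+ k *: (A *: y).
  have -> : (b ^+ k * (x i ^+ k * A)) *: v = (b ^+ k * A) *: (x i ^+ k *: v).
    by rewrite scalerA; congr (_ *: _); ring.
  rewrite e scalerDr addrC !scalerA -addSn exprD; congr (_ *: _ + _).
  by ring.
rewrite raddfD /=; have -> : ltop x' (t + k) (b ^+ k *: (A *: y)) = 0.
  apply/ltop_eq0; exists 0%N; rewrite addn0 big1 ?scale1r //.
  rewrite xsub'; apply: rpredZ; apply: addml; rewrite -addSn.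
  exact: prod_gensub.
by rewrite addr0.
Qed.

(** The limits for [x] and for [update x i c] are both compared with the one whose parameter at [i]
    is [x i * c]. *)
Lemma lim_independent x z n : param m M x -> param m M z ->
  soc_has_basis (koszul_lim M x d) n -> soc_has_basis (koszul_lim M z d) n.
Proof.
apply: (param_connected noethR localR noethM
  (P := fun x => soc_has_basis (koszul_lim M x d) n)) => {}x i c px pc.
move=> /(iffLR (lim_update_mul n px pc)) h.
have pb : param m M (update (update x i c) i (x i)) by rewrite update_update update_id.
by apply: (iffRL (lim_update_mul n pc pb)); rewrite update_update updateE mulrC.
Qed.

(** Injectivity of [ltop x 0] is limit closure. For surjectivity on socles, an element represented
    by [v] at stage [t] gives a socle element modulo the [x j ^+ t.+1], by [wregular_cancel], and
    [wregular_socle] brings it down to stage 0. *)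
Lemma limit_closed_lim x n (b : 'I_n -> M) : param m M x -> limit_closed M x ->
  socle_basis m (gensub M x xpredT) b -> soc_has_basis (koszul_lim M x d) n.
Proof.
move=> px hx hb; exists (ltop x 0 \o b); apply: (socle_basis_iso (f := ltop x 0)) hb =>
    [v|v vN|z hz].
- by move=> /zeroSP/ltop_eq0[s] /hx.
- apply/zeroSP/ltop_eq0; exists 0%N.
  by rewrite big1 ?scale1r ?xpow1.
have [t [v ez]] := ltop_surj z.
pose s := enum 'I_d; have us : uniq s := enum_uniq _.
have hs j : j \in s by rewrite mem_enum.
have ws := limit_closed_wregular noethR localR noethM px.1 us hx.
have [a am|w [hw1 hw2]] := wregular_socle (n := t) (S := fun a => a \in m) (v := v)
    px.1 ws.
  have : ltop x t (a *: v) = 0 by rewrite linearZ /= -ez; apply/zeroSP/hz.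
  move=> /ltop_eq0[k hk]; apply: (wregular_cancel (t := k)) => //.
  by rewrite (prod_all (fun j => x j ^+ k) us hs) (seqsub_all (xpow x (t + k).+1) hs).
exists w; split=> [a am|]; first by rewrite -(seqsub_all x hs); apply: hw2.
apply/zeroSP; rewrite /= -(ltop_raise x 0 t) ez -raddfB; apply/ltop_eq0; exists 0%N.
rewrite addn0 [X in X *: _]big1 ?scale1r => [|j _]; last exact: expr0.
by rewrite -(seqsub_all (xpow x t.+1) hs) -(prod_all (fun j => x j ^+ t) us hs).
Qed.

Lemma socle_nonzero (N : submodClosed M) w n (b : 'I_n -> M) : mprim m N -> w \notin N
    ->
  socle_basis m N b -> (0 < n)%N.
Proof.
case: n b => // b hN wN [_ b2 _]; have [c [cN mc]] := socle_elt noethR hN wN.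
by have [e] := b2 _ mc; rewrite big_ord0 subr0 (negPf cN).
Qed.

Lemma lim_limit_closed x n (b : 'I_n -> M) : param m M x ->
  soc_surjective m (@koszul_to_lim R M d x d) ->
  socle_basis m (gensub M x xpredT) b -> soc_has_basis (koszul_lim M x d) n ->
  limit_closed M x.
Proof.
move=> px /soc_surjective_top hsurj hb [b' hb'] t v hv.
have ltop0 u : u \in gensub M x xpredT -> ltop x 0 u = 0.
  move=> uN; apply/ltop_eq0; exists 0%N.
  by rewrite big1 ?scale1r ?xpow1.
have [b1 b2 b3] := hb.
have lsum (r : 'I_n -> R) : ltop x 0 (\sum_j r j *: b j) = \sum_j r j *: ltop x 0 (b j).
  by rewrite linear_sum; apply: eq_bigr => j _; rewrite linearZ.
have [||_ /(_ (erefl n)) indep] := socle_basis_span (c := fun j => ltop x 0 (b j)) hb'.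
- by move=> j a am; apply/zeroSP; rewrite -linearZ; apply/ltop0/b1.
- move=> i; have [b1' _ _] := hb'; have [|w [mw ew]] := hsurj (b' i).
    by move=> a am; apply/zeroSP/b1'.
  have [c hc] := b2 w mw; exists c; rewrite ew -lsum -raddfB.
  exact/zeroSP/ltop0.
(* If [v] were outside q M, it would have a socle multiple outside. The image of that multiple in
   the limit vanishes with that of [v], so independence forces its coefficients into [m]. *)
apply: contrapT => /negP vN.
have [c [cN mc]] := socle_elt noethR px.2 vN; have [r hr] := b2 _ mc.
move/negP: cN; apply; rewrite -[c *: v](subrK (\sum_j r j *: b j)) rpredD //.
apply: rpred_sum => j _; apply: b1; apply: indep; apply/zeroSP; rewrite -lsum.
have : ltop x 0 (c *: v - \sum_j r j *: b j) = 0 by apply: ltop0.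
rewrite raddfB /= => /eqP; rewrite subr_eq0 => /eqP <-; apply/ltop_eq0; exists t.
by rewrite scalerA mulrC -scalerA; apply: rpredZ.
Qed.

End LimitIso.

Lemma card_exponents d n :
  #|[set t : {ffun 'I_d.+1 -> 'I_n.+1} | (\sum_j t j == n)%N]| = 'C(n + d, d).
Proof.
rewrite addnC -card_ord_partitions.
pose f (t : d.+1.-tuple 'I_n.+1) : {ffun 'I_d.+1 -> 'I_n.+1} := [ffun j => tnth t j].
have finj : injective f.
  by move=> s t /ffunP e; apply: eq_from_tnth => j; have := e j; rewrite !ffunE.
rewrite -(card_imset _ finj); apply: eq_card => g; rewrite inE.
have sumf t : (\sum_j f t j = \sum_(i <- t) i)%N.
  by rewrite big_tuple; apply: eq_bigr => j _; rewrite ffunE.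
apply/idP/imsetP => [hg|[t]]; last by rewrite inE -sumf => ht ->.
have fg : f [tuple g j | j < d.+1] = g.
  by apply/ffunP => j; rewrite ffunE tnth_mktuple.
by exists [tuple g j | j < d.+1]; rewrite ?inE -?sumf fg.
Qed.

(** * Cohen-Macaulay modules *)

Section CohenMacaulay.
Variables (R : comNzRingType) (m : idealr R) (M : lmodType R) (d : nat).
Hypotheses (noethR : noethmod R^o) (localR : local_ring m) (noethM : noethmod M).
Hypothesis dimM : krull_dim M d.
Implicit Types (x y : 'I_d -> R) (u v w : M).

Lemma sop_param x : system_of_parameters m M x <-> param m M x.
Proof.
have e : mprim m (imul (ideal_gen x) (@predT M)) <-> mprim m (gensub M x xpredT).
  by split; apply: mprim_sub => v; rewrite imul_gen.
split=> [[_ [xm /(finite_lengthP noethR localR noethM)/e]]|[xm /e hx]] //.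
by split=> //; split=> //; apply/(finite_lengthP noethR localR noethM).
Qed.

Lemma exists_param : exists x, param m M x.
Proof.
have [|x [xm hx]] := exists_parameters noethR localR (I := annquot (zeroS M)) (n := d).
  move=> P k IP; apply: krull_dim_bound dimM _ => a ha; apply/IP/annquotP => v.
  by rewrite ha rpred0.
exists x; split=> //; apply: mprim_of_primes => // Q pQ xQ; apply: (hx Q) => // [a|j].
  move=> /annquotP ha; apply/xQ/annquotP => v; have /zeroSP -> := ha v; exact: rpred0.
by apply/xQ/annquotP => v; apply: mem_gensub.
Qed.

(** A prime containing the annihilator shows that [M] is nonzero; Nakayama's lemma does the rest. *)
Lemma gensub_proper n (x : 'I_n -> R) : (forall j, x j \in m) ->
  exists w, w \notin gensub M x xpredT.
Proof.
move=> xm; apply: contrapT => no.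
have [[P [annP _]] _] := dimM.
have /negP : 1 \notin P ord0 by rewrite idealr1.
apply; apply: annP => v; rewrite scale1r; apply/zeroSP.
apply: (nakayama noethR localR noethM (D := span (fun=> True))); last exact: mem_span.
move=> u _; apply: addSr.
have : u \in gensub M x xpredT by apply: contrapT => /negP h; apply: no; exists u.
apply: span_sub => _ [j [w [_ ->]]]; apply: mem_span; exists (x j), w; split=> //.
exact: mem_span.
Qed.

Lemma regular_wregular n (x : 'I_n -> R) :
  (forall (i : 'I_n) (v : quotmod (imul [pred a | `[< exists2 j : 'I_n, (j < i)%N & a =
      x j >]]
                         (@predT M))), x i *: v = 0 -> v = 0) <->
  wregular (zeroS M) [seq x j | j <- enum 'I_n].
Proof.
have e (i : 'I_n) : imul [pred a | `[< exists2 j : 'I_n, (j < i)%N & a = x j >]]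
    (@predT M)
    =i seqsub (zeroS M) (take i [seq x j | j <- enum 'I_n]).
  move=> v; rewrite -map_take seqsub_zero.
  have tk (j : 'I_n) : (j \in take i (enum 'I_n)) = (j < i)%N.
    by rewrite in_take ?mem_enum // index_enum_ord.
  apply/idP/idP; apply: span_sub.
    move=> _ [a [u [/asboolP[j ji ->] _ ->]]].
    by apply: mem_gensub; rewrite -[_ j]/(j \in _) tk.
  move=> _ [j [u [jt ->]]]; apply: mem_span; exists (x j), u; split=> //.
  by apply/asboolP; exists j => //; rewrite -tk.
have q0 (N : submodClosed M) u : quotmod_pi N u = 0 <-> u \in N.
  rewrite -(raddf0 (quotmod_pi N)) -[in X in _ <-> X](subr0 u); exact: quotmod_piE.
split=> [h|hw i v].
  apply: (@wregular_take _ _ _ _ 0) => k; rewrite size_map size_enum_ord => kn.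
  rewrite (nth_map (Ordinal kn)) ?size_enum_ord // (nth_ord_enum _ (Ordinal kn)).
  apply: nzd_ext (e (Ordinal kn)) _ => u xu; apply/q0/h.
  by rewrite -linearZ; apply/q0.
rewrite -[v]quotmod_pi_repr -linearZ => /q0 h; apply/q0; move: h; rewrite !e.
move: (quotmod_repr v) => u.
have := cat_take_drop i [seq x j | j <- enum 'I_n].
have dr : drop i [seq x j | j <- enum 'I_n] =
    x i :: drop i.+1 [seq x j | j <- enum 'I_n].
  have ks : (i < size (enum 'I_n))%N by rewrite size_enum_ord.
  have ks' : (i < size [seq x j | j <- enum 'I_n])%N by rewrite size_map.
  by rewrite (drop_nth 0 ks') (nth_map i) // nth_ord_enum.
rewrite dr => ee; move: hw; rewrite -ee.
have cat N s1 s2 : wregular N (s1 ++ s2) -> wregular (seqsub N s1) s2.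
  by elim: s1 N => //= a s1 IH N [_ /IH].
move=> /cat[nx _]; rewrite ee; exact: nx.
Qed.

(** A regular sequence [y] of length [d] in [m] is a system of parameters: a prime other than [m]
    above the annihilator of M / (y) M would start a chain of length 1, which [depth_chain] prolongs
    to length [d + 1]. Limit closure then passes from [y] to [x]. *)
Lemma cm_limit_closed x : cohen_macaulay m M -> param m M x -> limit_closed M x.
Proof.
move=> [n dimn [[y ym [/regular_wregular hy _]] _]] px.
have en : n = d.
  apply/eqP; rewrite eqn_leq; apply/andP; split; first exact: dimM.2 _ dimn.1.
  exact: dimn.2 _ dimM.1.
subst n; pose s := enum 'I_d.
have us : uniq s := enum_uniq _; have hs j : j \in s by rewrite mem_enum.
have py : param m M y.
  split=> //; apply: mprim_of_primes => // Q pQ yQ; apply: contrapT => nmQ.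
  have ch : prime_chain 1 Q.
    split=> //; exists (ideal_sub m); split.
    - by move=> a aQ; apply/ideal_subP; apply: (mprime_sub noethR localR pQ).
    - by move=> mQ; apply: nmQ => a am; apply/mQ/ideal_subP.
    by split=> //; exact: isprime_max.
  have [|Q' [Q'0 ch']] := depth_chain noethR hy ch.
    by move=> a /annquotP ha; apply/yQ/annquotP => v; rewrite -(seqsub_all y hs).
  have : (size [seq y j | j <- s] + 1 <= d)%N.
    apply: krull_dim_bound dimM _ ch' => a ha; apply/Q'0/annquotP => v.
    by rewrite ha rpred0.
  by rewrite size_map size_enum_ord addn1 ltnn.
apply: (param_connected noethR localR noethM _ py px); last exact:
    wregular_limit_closed us hs hy.
exact: limit_closed_update.
Qed.

Lemma limit_closed_cm x : param m M x -> limit_closed M x -> cohen_macaulay m M.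
Proof.
move=> px hx; exists d => //; split.
  exists x; first exact: px.1.
  split; first exact/regular_wregular/limit_closed_wregular/hx/enum_uniq/px.1.
  have [w wN] := gensub_proper px.1 => h; move/negP: wN; apply.
  by rewrite -imul_gen h.
move=> k y ym [/regular_wregular hy ny].
have hs (j : 'I_k) : j \in enum 'I_k by rewrite mem_enum.
have chm : prime_chain 0 (ideal_sub m) by split=> //; exact: isprime_max.
have [|Q [Q0 ch]] := depth_chain noethR hy chm.
  move=> a /annquotP ha; apply/ideal_subP; apply: contrapT => /negP am; apply: ny => v.
  have [b eb] := local_unit noethR localR am.
  rewrite imul_gen -(seqsub_all y hs) -[v]scale1r -eb mulrC -scalerA.
  by rewrite ha.
rewrite -[k](size_enum_ord) -(size_map y) -[size _]addn0.
by apply: krull_dim_bound dimM _ ch => a h; apply/Q0/annquotP => v; rewrite h rpred0.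
Qed.

(** The index [i0] records that [d] is positive: a socle element is killed by [x i0], so
    [limit_closed_socle] places it in [powsub x n]. By [limit_closed_indep] its coefficients are
    then socle elements modulo q M. *)
Lemma powsub_socle_basis x n r (b : 'I_r -> M) (i0 : 'I_d) : (forall j, x j \in m) ->
  limit_closed M x ->
  socle_basis m (gensub M x xpredT) b ->
  let A := [set t : {ffun 'I_d -> 'I_n.+1} | (\sum_j t j == n)%N] in
  socle_basis m (powsub M x n.+1) (fun p : 'I_#|A| * 'I_r =>
    mon x (fun j => (enum_val p.1 : {ffun 'I_d -> 'I_n.+1}) j : nat) *: b p.2).
Proof.
move=> xm hx [b1 b2 b3] A; pose mt (t : {ffun 'I_d -> 'I_n.+1}) := mon x (fun j => t j
    : nat).
have At (k : 'I_#|A|) : (\sum_j (enum_val k : {ffun _}) j = n)%N.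
  by have := enum_valP k; rewrite inE => /eqP.
have sumA (F : {ffun 'I_d -> 'I_n.+1} -> M) :
    \sum_(t : {ffun 'I_d -> 'I_n.+1} | (\sum_j t j == n)%N) F t = \sum_(k < #|A|) F
        (enum_val k).
  by rewrite -(big_enum_val (A := mem A) F); apply: eq_bigl => t; rewrite inE.
have sumT (c : 'I_#|A| * 'I_r -> R) : \sum_p c p *: (mt (enum_val p.1) *: b p.2) =
    \sum_(k < #|A|) mt (enum_val k) *: \sum_i c (k, i) *: b i.
  rewrite (eq_bigr (fun p => c (p.1, p.2) *: (mt (enum_val p.1) *: b p.2))); last by
      case.
  rewrite -(pair_bigA _ (fun k i => c (k, i) *: (mt (enum_val k) *: b i))) /=.
  apply: eq_bigr => k _; rewrite scaler_sumr; apply: eq_bigr => i _.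
  by rewrite !scalerA mulrC.
split=> [[k i] a am|v mv|c hc [k i]] /=.
- by rewrite scalerA mulrC -scalerA; apply: mon_gensub => //; apply: b1.
- have /powsubP[w ev] : v \in powsub M x n.
    by apply: (limit_closed_socle (i := i0) hx); apply: mv; apply: xm.
  have /choice[c hc] (k : 'I_#|A|) : exists c : 'I_r -> R,
      w (enum_val k) - \sum_i c i *: b i \in gensub M x xpredT.
    apply: b2 => a am.
    apply: (@limit_closed_indep _ _ _ x n (fun t => a *: w t) (enum_val k) hx _ (At k)).
    have := mv a am; rewrite ev scaler_sumr; under eq_bigr do rewrite scalerA mulrC
        -scalerA.
    by [].
  exists (fun p => c p.1 p.2); rewrite sumT ev sumA -sumrB; apply: rpred_sum => k _.
  by rewrite -scalerBr; apply: mon_gensub.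
pose w t := \sum_(k' < #|A| | enum_val k' == t) \sum_i c (k', i) *: b i.
have wE k' : w (enum_val k') = \sum_i c (k', i) *: b i.
  by rewrite /w (big_pred1 k') // => k2; rewrite (inj_eq enum_val_inj).
have := @limit_closed_indep _ _ _ x n w (enum_val k) hx _ (At k); rewrite wE => hw.
have {}hw := b3 (fun i => c (k, i)) (hw _) i; apply: hw.
by rewrite sumA; under eq_bigr do rewrite wE; rewrite -sumT.
Qed.

End CohenMacaulay.

Lemma powsub1 (R : comNzRingType) (M : lmodType R) d (x : 'I_d -> R) :
  powsub M x 1 =i gensub M x xpredT.
Proof.
move=> v; apply/idP/idP; apply: span_sub => _ [e [u [he ->]]].
  have [|j hj] := @pigeonhole _ 0 e; first by rewrite muln0.
  by have := @mon_xpow _ _ _ x e 1 j u hj; rewrite xpow1.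
by rewrite -(mon_delta x); apply: mem_monspan; apply: sum_delta.
Qed.

Lemma ideal_gen_xpow (R : comNzRingType) (m : idealr R) d (x : 'I_d -> R) l :
  (forall j, x j \in m) -> {subset ideal_gen (xpow x l.+1) <= ipow m l.+1}.
Proof.
move=> xm; have xl j k : x j ^+ k \in ipow m k.
  elim: k => // k IH; apply: mem_span; exists (x j), (x j ^+ k); split=> //.
  by rewrite exprS.
by apply: (@span_sub R R^o _ (imul m (ipow m l : {pred R^o}))) => _ [j ->]; apply: xl.
Qed.

Theorem theorem5p2 (R : comNzRingType) (m : idealr R) (M : lmodType R)
    (d l : nat)
    (noethR : noetherian R) (localR : local_ring m)
    (fgM : finitely_generated M) (dimM : krull_dim M d) (l_gt0 : (0 < l)%N)
    (soc_surj : forall x : 'I_d -> R, system_of_parameters m M x ->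
       {subset ideal_gen x <= ipow m l} ->
       forall i : nat, soc_surjective m (@koszul_to_lim R M d x i)) :
  [<->
    cohen_macaulay m M;
    forall (x : 'I_d -> R) (n : nat), system_of_parameters m M x ->
      index_reducibility (imul (ipow (ideal_gen x) n.+1) (@predT M)) =
      (basis_dim (soc m (local_cohomology m M d d)) * 'C(n + d - 1, d - 1))%N;
    forall x : 'I_d -> R, system_of_parameters m M x ->
      index_reducibility (imul (ideal_gen x) (@predT M)) =
      basis_dim (soc m (local_cohomology m M d d));
    exists x : 'I_d -> R,
      [/\ system_of_parameters m M x,
          {subset ideal_gen x <= ipow m l} &
          index_reducibility (imul (ideal_gen x) (@predT M)) =
          basis_dim (soc m (local_cohomology m M d d))]].
Proof.
have nR := noethmod_ring noethR; have nM := noethmodP noethR fgM.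
have sopP x := sop_param nR localR nM dimM x.
(* The system chosen by [local_cohomology], to which every other one is compared. *)
pose x0 : 'I_d -> R := classical_sets.xget (fun=> 0)
  (fun x : 'I_d -> R => system_of_parameters m M x).
have px0 : param m M x0.
  apply/sopP; apply: (@classical_sets.xgetPex _ (fun=> 0) (fun x : 'I_d -> R =>
      system_of_parameters m M x)).
  by have [x px] := exists_param nR localR dimM; exists x; apply/sopP.
pose e := basis_dim (soc m (local_cohomology m M d d)); rewrite -/e.
have irE (N : {pred M}) (N' : submodClosed M) (T : finType) (b : T -> M) :
    N =i N' -> mprim m N' -> socle_basis m N' b -> index_reducibility N = #|T|.
  by move=> NN' hN' hb; rewrite (index_reducibility_ext NN') (index_reducibilityE nR
      localR nM hN' hb).
tfae.
- move=> hcm x n /sopP px; have hx := cm_limit_closed nR localR nM dimM hcm px.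
  have [r [b hb]] := exists_socle_basis nR localR nM px.2.
  have er : e = r.
    have /(lim_independent nR localR nM px px0)[b' hb'] := limit_closed_lim nR localR
        nM px hx hb.
    exact: basis_dim_socle_basis hb'.
  have hQ : mprim m (powsub M x n.+1) by apply: mprim_powsub px.2.
  (* For [d = 0] the truncated subtraction makes the binomial coefficient 1, and both q M and
     q^(n+1) M are zero. *)
  rewrite er; case: (d) x px hx hb hQ => [|d'] x px hx hb hQ.
    have QE : gensub M x xpredT =i powsub M x n.+1.
      move=> v; apply/idP/idP; apply: span_sub => _ [i [u [Si ->]]]; first by case: i
          Si.
      by rewrite big_ord0 in Si.
    by rewrite (irE _ _ _ _ (powsub_imul x n.+1) hQ (socle_basis_ext QE hb)) card_ord
        bin0 muln1.
  rewrite (irE _ _ _ _ (powsub_imul x n.+1) hQ (powsub_socle_basis n ord0 px.1 hx hb)).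
  by rewrite card_prod !card_ord card_exponents mulnC addnS !subn1.
- move=> h x sx; have := h x 0%N sx; rewrite add0n binn muln1 => <-.
  apply: index_reducibility_ext => v; by rewrite imul_gen powsub_imul powsub1.
- move=> h; have [x px] := exists_param nR localR dimM.
  case: l l_gt0 soc_surj => // l' _ _.
  have pxl := param_xpow l' px; have sxl : system_of_parameters m M (xpow x l'.+1) by
      apply/sopP.
  by exists (xpow x l'.+1); split=> //; [exact: ideal_gen_xpow px.1 | exact: h].
move=> [x [sx xl ex]]; have px : param m M x by apply/sopP.
have [r [b hb]] := exists_socle_basis nR localR nM px.2.
have er : e = r by rewrite -ex (irE _ _ _ _ (imul_gen x) px.2 hb) card_ord.
have [w wN] := gensub_proper nR localR nM dimM px.1.
have r0 := socle_nonzero nR px.2 wN hb.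
(* Since [r] is positive, [e] is not the default value of [basis_dim], so a socle basis of the limit
   with [r] elements exists. *)
have hlim : soc_has_basis m (koszul_lim M x0 d) r.
  apply/has_dim_socle_basis; rewrite -er.
  apply: (@classical_sets.xgetPex _ 0%N (fun n => has_dim (soc m (koszul_lim M x0 d))
      n)).
  apply: contrapT => no; move: r0; rewrite -er /e /basis_dim classical_sets.xgetPN //.
  by move=> n hn; apply: no; exists n.
apply: (limit_closed_cm nR localR nM dimM px).
have hlim' := lim_independent nR localR nM px0 px hlim.
exact: (@lim_limit_closed _ _ nR _ _ _ _ _ px (soc_surj x sx xl d) hb hlim').
Qed.
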